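(* Let $(A,[\cdot,\cdot],\rho)$ be a Lie algebroid with differential $d^A$ and associated multiplicative graded Lie algebra structure $l_2^{[\cdot,\cdot]}$ on the graded vector space $\Gamma(\wedge A)[2]$. If $(\alpha,N)$ is an $\Omega N$-structure on the Lie algebroid $A$, then $\underline N+\underline\alpha$ is a Nijenhuis vector valued form with respect to $l_2^{[\cdot,\cdot]}$, with square $\underline{N^2}+\underline{\alpha_{_N}}$, where $\alpha_{_N}(X,Y)=\alpha(NX,Y)$.
   Context: Let $(A,[\cdot,\cdot],\rho)$ be a Lie algebroid over $M$, $d^A$ its differential on $\Gamma(\wedge A^* )$. Let $N$ be a $(1,1)$-tensor on $A$ (a bundle endomorphism of $A$) and $\alpha\in\Gamma(\wedge^2A^* )$ a $2$-form; put $\alpha_{_N}(X,Y)=\alpha(NX,Y)$ for $X,Y\in\Gamma(A)$. The pair $(\alpha,N)$ is an $\Omega N$-structure on $A$ if $\alpha(NX,Y)=\alpha(X,NY)$ for all $X,Y\in\Gamma(A)$ (which amounts to $\alpha_{_N}$ being skew-symmetric and therefore a $2$-form on $A$), and $\alpha$ and $\alpha_{_N}$ are $d^A$-closed. $\Gamma(\wedge A)[2]$ is $\Gamma(\wedge A)$ graded so that $\Gamma(\wedge^pA)$ has degree $p-2$. $[\cdot,\cdot]_{_{SN}}$ is the Schouten-Nijenhuis bracket: it extends the Lie bracket, $[X,f]_{_{SN}}=\rho(X)f$, $[P,Q]_{_{SN}}=-(-1)^{(p-1)(q-1)}[Q,P]_{_{SN}}$, $[P,Q\wedge R]_{_{SN}}=[P,Q]_{_{SN}}\wedge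 R+(-1)^{(p-1)q}Q\wedge[P,R]_{_{SN}}$. $l_2^{[\cdot,\cdot]}(P,Q)=(-1)^{p-1}[P,Q]_{_{SN}}$ for $P\in\Gamma(\wedge^pA)$, $Q\in\Gamma(\wedge^qA)$; ''multiplicative'' means that the bracket is a graded derivation of $\wedge$ in each argument. For a $(1,1)$-tensor $N$, its extension by derivation $\underline N$ is the degree-zero linear map with $\underline N(f)=0$ on functions and $\underline N(P_1\wedge\cdots\wedge P_p)=\sum_iP_1\wedge\cdots\wedge N(P_i)\wedge\cdots\wedge P_p$. For a $2$-form $\kappa\in\Gamma(\wedge^2A^* )$, its extension by derivation $\underline\kappa$ is the symmetric vector valued $2$-form of degree zero on $\Gamma(\wedge A)[2]$ given, for $P=P_1\wedge\cdots\wedge P_p$ and $Q=Q_1\wedge\cdots\wedge Q_q$, by $$\underline\kappa(P,Q)=\sum_{i=1}^p\sum_{j=1}^q(-1)^{2p+3q+i+j+1}\kappa(P_i,Q_j)\,\widehat{P_i}\wedge\widehat{Q_j},$$ where $\widehat{P_i}$ is $P$ with the factor $P_i$ removed and $\widehat{Q_j}$ is $Q$ with the factor $Q_j$ removed (the sum is empty, hence zero, if an argument is a function). A symmetric vector valued $k$-form on a graded vector space $E$ is a graded symmetric $k$-linear map $K:E^k\to E$ ($k=0$: an element of $E$), of degree $\bar K$ if $|K(X_1,\dots,X_k)|=\sum|X_i|+\bar K$. For a $k$-form $K$ and an $l$-form $L$ ($l\ge1$), $\iota_KL(X_1,\dots,X_{k+l-1})=\sum_{\sigma\in Sh(k,l-1)}\epsilon(\sigma)L(K(X_{\sigma(1)},\dots,X_{\sigma(k)}),\dots,X_{\sigma(k+l-1)})$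 (unshuffles, Koszul sign); $\iota_KL=0$ for $L\in E$; $\iota_XK=K(X,\cdot,\dots)$ for $X\in E$. $[K,L]_{_{RN}}=\iota_KL-(-1)^{\bar K\bar L}\iota_LK$, extended to sums. For $\mu$ of degree $1$, $\mathcal N$ of degree zero is Nijenhuis with respect to $\mu$ with square $\mathcal K$ (of degree zero) if $[\mathcal N,[\mathcal N,\mu]_{_{RN}}]_{_{RN}}=[\mathcal K,\mu]_{_{RN}}$ and $[\mathcal N,\mathcal K]_{_{RN}}=0$.
   Formalization: N is also assumed to have vanishing Nijenhuis torsion (the conclusion forces it; the claim fails without it), and the sign in the extension by derivation of a 2-form is (-1)^(3p+2q+i+j+1) instead of (-1)^(2p+3q+i+j+1), since the printed sign gives no derivation of the wedge product. *)

(* Defs.v *)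
From HB Require Import structures.
From mathcomp Require Import all_boot all_order all_fingroup all_algebra.
From mathcomp Require Import all_classical all_reals all_analysis.

Set Implicit Arguments.
Unset Strict Implicit.
Unset Printing Implicit Defensive.

Import Order.TTheory GRing.Theory Num.Theory.
Import numFieldNormedType.Exports.

Local Open Scope classical_set_scope.
Local Open Scope ring_scope.

(** * Smooth manifolds *)

Fixpoint Ck_on (R : realType) (n k : nat) (U : set 'rV[R]_n)
    (f : 'rV[R]_n -> R) : Prop :=
  match k with
  | 0 => forall x, U x -> {for x, continuous f}
  | k'.+1 => (forall x, U x -> differentiable f x) /\
             forall v : 'rV[R]_n, Ck_on k' U (fun x => 'D_v f x)
  end.

(* Meant for open [U] only. *)
Definition smooth_on (R : realType) (n : nat) (U : set 'rV[R]_n)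
    (f : 'rV[R]_n -> R) : Prop := forall k, Ck_on k U f.

(* The maps [chart i] and [chart_inv i] are total, but only their restrictions
   to [chart_dom i] and to [chart i @` chart_dom i] matter. *)
Record manifold (R : realType) (n : nat) := Manifold {
  mspace :> topologicalType;
  chart_index : Type;
  chart_dom : chart_index -> set mspace;
  chart : chart_index -> mspace -> 'rV[R]_n;
  chart_inv : chart_index -> 'rV[R]_n -> mspace;
  manifold_hausdorff : hausdorff_space mspace;
  manifold_second_countable : @second_countable mspace;
  chart_cover : forall x, exists i, chart_dom i x;
  chart_dom_open : forall i, open (chart_dom i);
  chart_im_open : forall i, open (chart i @` chart_dom i);
  chartK : forall i x, chart_dom i x -> chart_inv i (chart i x) = x;
  chart_continuous : forall i, {within chart_dom i, continuous (chart i)};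
  chart_inv_continuous : forall i,
    {within chart i @` chart_dom i, continuous (chart_inv i)};
  chart_transition : forall i j (k : 'I_n),
    smooth_on (chart i @` (chart_dom i `&` chart_dom j))
              (fun y => chart j (chart_inv i y) ord0 k) }.

(* Smoothness of [f] on the open subset [V] of [M]. *)
Definition smooth_fun (R : realType) (n : nat) (M : manifold R n)
    (V : set M) (f : M -> R) : Prop :=
  forall i : chart_index M,
    smooth_on (chart i @` (chart_dom i `&` V)) (fun y => f (chart_inv i y)).

(** * Vector bundles *)

(* Each fibre is identified with the vector space [R^r] (row vectors) by an
   arbitrary linear isomorphism, with no regularity in the base point; the
   smooth structure of the bundle is carried by the local frames: the rows of
   [frame j x] are the values at [x] of the j-th local frame. *)
Record vbundle (R : realType) (n : nat) (M : manifold R n) (r : nat) :=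
  VBundle {
  frame_index : Type;
  frame_dom : frame_index -> set M;
  frame : frame_index -> M -> 'M[R]_r;
  frame_cover : forall x, exists j, frame_dom j x;
  frame_dom_open : forall j, open (frame_dom j);
  frame_unit : forall j x, frame_dom j x -> frame j x \in unitmx;
  frame_transition : forall i j (a b : 'I_r),
    smooth_fun (frame_dom i `&` frame_dom j)
               (fun x => (frame i x *m invmx (frame j x)) a b) }.

Section Sections.
Context (R : realType) (n : nat) (M : manifold R n) (r : nat).
Context (A : vbundle M r).

(* C^oo(M) *)
Definition Cinf (f : M -> R) : Prop := smooth_fun setT f.

(* X belongs to Gamma(A): its coordinates in each local frame are smooth. *)
Definition Gamma (X : M -> 'rV[R]_r) : Prop :=
  forall (j : frame_index A) (b : 'I_r),
    smooth_fun (frame_dom j) (fun x => (X x *m invmx (frame j x)) ord0 b).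

(* A (1,1)-tensor acts on sections on the right: (N X)(x) = X x *m N x. *)
Definition tensor11 (N : M -> 'M[R]_r) : Prop :=
  forall (j : frame_index A) (a b : 'I_r),
    smooth_fun (frame_dom j)
      (fun x => (frame j x *m N x *m invmx (frame j x)) a b).

Definition tapp (N : M -> 'M[R]_r) (X : M -> 'rV[R]_r) : M -> 'rV[R]_r :=
  fun x => X x *m N x.

Definition tsquare (N : M -> 'M[R]_r) : M -> 'M[R]_r := fun x => N x *m N x.

(* A 2-form is given by its Gram matrices:
   alpha(X,Y)(x) = X x *m alpha x *m (Y x)^T. *)
Definition feval (alpha : M -> 'M[R]_r) (X Y : M -> 'rV[R]_r) : M -> R :=
  fun x => (X x *m alpha x *m (Y x)^T) ord0 ord0.

Definition two_form (alpha : M -> 'M[R]_r) : Prop :=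
  (forall x, (alpha x)^T = - alpha x) /\
  forall (j : frame_index A) (a b : 'I_r),
    smooth_fun (frame_dom j)
      (fun x => (frame j x *m alpha x *m (frame j x)^T) a b).

(* alpha_N(X,Y) = alpha(NX,Y) *)
Definition twist (alpha N : M -> 'M[R]_r) : M -> 'M[R]_r :=
  fun x => N x *m alpha x.

End Sections.

(** * Lie algebroids *)

(* The bundle map rho : A -> TM is given by the Cinf(M)-linear map it induces
   from sections to vector fields, i.e. to derivations of Cinf(M). The two
   operations are total, but constrained on smooth arguments only. *)
Record lie_algebroid (R : realType) (n : nat) (M : manifold R n) (r : nat)
    (A : vbundle M r) := LieAlgebroid {
  lbr : (M -> 'rV[R]_r) -> (M -> 'rV[R]_r) -> (M -> 'rV[R]_r);
  anchor : (M -> 'rV[R]_r) -> (M -> R) -> (M -> R);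
  lbr_Gamma : forall X Y, Gamma A X -> Gamma A Y -> Gamma A (lbr X Y);
  lbr_linear : forall (a : R) X Y Z,
    Gamma A X -> Gamma A Y -> Gamma A Z ->
    lbr (a *: X + Y) Z = a *: lbr X Z + lbr Y Z;
  lbr_skew : forall X Y, Gamma A X -> Gamma A Y -> lbr X Y = - lbr Y X;
  lbr_jacobi : forall X Y Z, Gamma A X -> Gamma A Y -> Gamma A Z ->
    lbr X (lbr Y Z) = lbr (lbr X Y) Z + lbr Y (lbr X Z);
  anchor_Cinf : forall X f, Gamma A X -> Cinf f -> Cinf (anchor X f);
  anchor_additive : forall (a : R) X f g, Gamma A X -> Cinf f -> Cinf g ->
    anchor X (fun x => a * f x + g x) =
    (fun x => a * anchor X f x + anchor X g x);
  anchor_derivation : forall X f g, Gamma A X -> Cinf f -> Cinf g ->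
    anchor X (fun x => f x * g x) =
    (fun x => anchor X f x * g x + f x * anchor X g x);
  anchor_Clinear : forall f X Y g,
    Cinf f -> Gamma A X -> Gamma A Y -> Cinf g ->
    anchor (fun x => f x *: X x + Y x) g =
    (fun x => f x * anchor X g x + anchor Y g x);
  lbr_leibniz : forall X f Y, Gamma A X -> Cinf f -> Gamma A Y ->
    lbr X (fun x => f x *: Y x) =
    (fun x => f x *: lbr X Y x + anchor X f x *: Y x) }.

Section OmegaN.
Context (R : realType) (n : nat) (M : manifold R n) (r : nat).
Context (A : vbundle M r) (L : lie_algebroid A).

(* (d^A alpha)(X,Y,Z) *)
Definition dA2 (alpha : M -> 'M[R]_r) (X Y Z : M -> 'rV[R]_r) : M -> R :=
  fun x =>
    anchor L X (feval alpha Y Z) x - anchor L Y (feval alpha X Z) x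
    + anchor L Z (feval alpha X Y) x
    - feval alpha (lbr L X Y) Z x + feval alpha (lbr L X Z) Y x
    - feval alpha (lbr L Y Z) X x.

Definition dA_closed (alpha : M -> 'M[R]_r) : Prop :=
  forall X Y Z, Gamma A X -> Gamma A Y -> Gamma A Z ->
    dA2 alpha X Y Z = (fun=> 0).

(* No condition on the torsion of N is included here; see [torsion_free]. *)
Definition OmegaN (alpha N : M -> 'M[R]_r) : Prop :=
  [/\ forall X Y, Gamma A X -> Gamma A Y ->
        feval alpha (tapp N X) Y = feval alpha X (tapp N Y),
      dA_closed alpha &
      dA_closed (twist alpha N)].

(* N is a Nijenhuis tensor: its torsion
   T_N(X,Y) = [NX,NY] - N[NX,Y] - N[X,NY] + N^2[X,Y] vanishes. On X, Y in
   Gamma(A), [uN,[uN,l2]]_RN - [uN2,l2]_RN takes the value 2 T_N(X,Y), so this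
   is necessary for uN + ualpha to be Nijenhuis with square uN2 + ualphaN. *)
Definition torsion_free (N : M -> 'M[R]_r) : Prop :=
  forall X Y, Gamma A X -> Gamma A Y ->
    lbr L (tapp N X) (tapp N Y) - tapp N (lbr L (tapp N X) Y)
    - tapp N (lbr L X (tapp N Y)) + tapp N (tapp N (lbr L X Y)) = 0.

End OmegaN.

(** * The exterior algebra and its sections *)

(* The exterior algebra of R^r: [a S] is the coefficient of the monomial
   e_{s_1} /\ ... /\ e_{s_p}, where S = {s_1 < ... < s_p}. *)
Definition ext (R : realType) (r : nat) := {ffun {set 'I_r} -> R^o}.

Section Exterior.
Context (R : realType) (r : nat).

(* e_S /\ e_T = (-1)^(inversions S T) e_(S :|: T) for disjoint S and T *)
Definition inversions (S T : {set 'I_r}) : nat :=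
  #|[set p : 'I_r * 'I_r | [&& p.1 \in S, p.2 \in T & (p.2 < p.1)%N]]%SET|.

Definition extmul (a b : ext R r) : ext R r :=
  [ffun U : {set 'I_r} => \sum_(S : {set 'I_r} | S \subset U)
     (-1) ^+ inversions S (U :\: S) * a S * b (U :\: S)].

Definition ext1 : ext R r := [ffun S : {set 'I_r} => (S == finset.set0)%:R].

Definition extvec (v : 'rV[R]_r) : ext R r :=
  [ffun S : {set 'I_r} => \sum_(i | S == [set i]%SET) v ord0 i].

(* v_1 /\ ... /\ v_p *)
Definition extprod (s : seq 'rV[R]_r) : ext R r :=
  foldr (fun v a => extmul (extvec v) a) ext1 s.

End Exterior.

Section Multivectors.
Context (R : realType) (n : nat) (M : manifold R n) (r : nat).
Context (A : vbundle M r).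

(* P belongs to Gamma(/\A): on the domain of each local frame (e_i), P is a
   combination of the e_{s_1} /\ ... /\ e_{s_p} with smooth coefficients. *)
Definition GammaExt (P : M -> ext R r) : Prop :=
  forall j : frame_index A, exists c : {set 'I_r} -> M -> R,
    (forall S, smooth_fun (frame_dom j) (c S)) /\
    forall x, frame_dom j x ->
      P x = \sum_(S : {set 'I_r})
              c S x *: extprod [seq row i (frame j x) | i <- enum S].

(* P belongs to Gamma(/\^p A), which is 0 if p < 0. *)
Definition GammaExtP (p : int) (P : M -> ext R r) : Prop :=
  GammaExt P /\ forall x (S : {set 'I_r}), P x S != 0 -> #|S|%:Z = p.

(* The homogeneous elements of Gamma(/\A)[2] *)
Definition GammaExt2 (d : int) (P : M -> ext R r) : Prop := GammaExtP (d + 2) P.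

Definition mvfun (f : M -> R) : M -> ext R r := fun x => f x *: ext1 R r.

Definition mvvec (X : M -> 'rV[R]_r) : M -> ext R r := fun x => extvec (X x).

Definition wedge (P Q : M -> ext R r) : M -> ext R r :=
  fun x => extmul (P x) (Q x).

(* P_1 /\ ... /\ P_p *)
Definition wedges (s : seq (M -> 'rV[R]_r)) : M -> ext R r :=
  foldr (fun X P => wedge (mvvec X) P) (mvfun (fun=> 1)) s.

Definition Gamma_seq (s : seq (M -> 'rV[R]_r)) : Prop :=
  forall i, (i < size s)%N -> Gamma A (nth (fun=> 0) s i).

Definition omit (T : Type) (i : nat) (s : seq T) := take i s ++ drop i.+1 s.

(* [uN] is the extension by derivation of the (1,1)-tensor [N]. The empty
   product gives uN(1) = 0, hence uN(f) = 0 by linearity over Cinf(M). *)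
Definition ext_tensor (N : M -> 'M[R]_r)
    (uN : (M -> ext R r) -> (M -> ext R r)) : Prop :=
  [/\ forall p P, GammaExtP p P -> GammaExtP p (uN P),
      forall f P Q, Cinf f -> GammaExt P -> GammaExt Q ->
        uN (fun x => f x *: P x + Q x) = (fun x => f x *: uN P x + uN Q x) &
      forall s : seq (M -> 'rV[R]_r), Gamma_seq s ->
        uN (wedges s) = \sum_(i < size s)
          wedges (set_nth (fun=> 0) s i (tapp N (nth (fun=> 0) s i)))].

(* [uk] is the extension by derivation of the 2-form [kappa]. With p = size s,
   q = size t and indices starting from 1, the sign is (-1)^(3p+2q+i+j+1): it is
   the one for which uk is a graded derivation of /\ in each argument,
     uk(P, Q /\ S) = uk(P,Q) /\ S + (-1)^(pq) Q /\ uk(P,S).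
   (With 2p+3q instead of 3p+2q, uk is not a derivation, and uk(X, Y /\ Z) has
   the opposite sign.) *)
Definition ext_form (kappa : M -> 'M[R]_r)
    (uk : (M -> ext R r) -> (M -> ext R r) -> (M -> ext R r)) : Prop :=
  [/\ forall p q P Q, GammaExtP p P -> GammaExtP q Q ->
        GammaExtP (p + q - 2) (uk P Q),
      forall f P P' Q, Cinf f -> GammaExt P -> GammaExt P' -> GammaExt Q ->
        uk (fun x => f x *: P x + P' x) Q =
        (fun x => f x *: uk P Q x + uk P' Q x),
      forall f P Q Q', Cinf f -> GammaExt P -> GammaExt Q -> GammaExt Q' ->
        uk P (fun x => f x *: Q x + Q' x) =
        (fun x => f x *: uk P Q x + uk P Q' x) &
      forall s t : seq (M -> 'rV[R]_r), Gamma_seq s -> Gamma_seq t ->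
        uk (wedges s) (wedges t) =
        (fun x => \sum_(i < size s) \sum_(j < size t)
           ((-1) ^+ (3 * size s + 2 * size t + i.+1 + j.+1 + 1)
            * feval kappa (nth (fun=> 0) s i) (nth (fun=> 0) t j) x)
           *: wedge (wedges (omit i s)) (wedges (omit j t)) x)].

(* [SN] is the Schouten-Nijenhuis bracket. *)
Definition schouten (L : lie_algebroid A)
    (SN : (M -> ext R r) -> (M -> ext R r) -> (M -> ext R r)) : Prop :=
  [/\ forall p q P Q, GammaExtP p P -> GammaExtP q Q ->
        GammaExtP (p + q - 1) (SN P Q),
      (forall (a : R) P P' Q, GammaExt P -> GammaExt P' -> GammaExt Q ->
        SN (a *: P + P') Q = a *: SN P Q + SN P' Q) /\
      (forall (a : R) P Q Q', GammaExt P -> GammaExt Q -> GammaExt Q' ->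
        SN P (a *: Q + Q') = a *: SN P Q + SN P Q'),
      (forall X Y, Gamma A X -> Gamma A Y ->
        SN (mvvec X) (mvvec Y) = mvvec (lbr L X Y)) /\
      (forall X f, Gamma A X -> Cinf f ->
        SN (mvvec X) (mvfun f) = mvfun (anchor L X f)),
      forall p q P Q, GammaExtP p P -> GammaExtP q Q ->
        SN P Q = - ((-1 : R) ^ ((p - 1) * (q - 1))) *: SN Q P &
      forall p q P Q S, GammaExtP p P -> GammaExtP q Q -> GammaExt S ->
        SN P (wedge Q S) =
        wedge (SN P Q) S + ((-1 : R) ^ ((p - 1) * q)) *: wedge Q (SN P S)].

End Multivectors.

(** * Symmetric vector valued forms on a graded vector space *)

(* [H d] is the subspace of homogeneous elements of degree [d] of [E]. *)
Section VectorValuedForms.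
Context (R : realType) (E : lmodType R) (H : int -> E -> Prop).

(* A (sum of) vector valued form(s) is evaluated on finite lists of homogeneous
   elements, each of them listed with its degree; its component of arity k is
   its restriction to the lists of size k. *)
Definition vform := seq (int * E) -> E.

Definition homogeneous (s : seq (int * E)) : Prop :=
  {in s, forall x, H x.1 x.2}.

Definition degsum (s : seq (int * E)) : int := \sum_(x <- s) x.1.

Definition sym_vform (d : int) (K : vform) : Prop :=
  [/\ forall s, homogeneous s -> H (degsum s + d) (K s),
      forall (s t : seq (int * E)) e (a : R) u v,
        homogeneous s -> homogeneous t -> H e u -> H e v ->
        K (s ++ (e, a *: u + v) :: t) =
        a *: K (s ++ (e, u) :: t) + K (s ++ (e, v) :: t) &
      forall (s t : seq (int * E)) x y,
        homogeneous s -> homogeneous t -> H x.1 x.2 -> H y.1 y.2 ->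
        K (s ++ x :: y :: t) = ((-1 : R) ^ (x.1 * y.1)) *: K (s ++ y :: x :: t)].

(* sigma is increasing on {0,..,k-1} and on {k,..,m-1} *)
Definition unshuffle (m k : nat) (sigma : 'S_m) : bool :=
  [forall i : 'I_m, forall j : 'I_m,
     (i < j)%N && ((j < k)%N || (k <= i)%N) ==> (sigma i < sigma j)%N].

Definition permute (s : seq (int * E)) (sigma : 'S_(size s)) : seq (int * E) :=
  [seq nth (0, 0) s (sigma i) | i <- enum 'I_(size s)].

Definition koszul (s : seq (int * E)) (sigma : 'S_(size s)) : R :=
  \prod_(i < size s) \prod_(j < size s | (i < j)%N && (sigma j < sigma i)%N)
    (-1) ^ ((nth (0, 0) s (sigma i)).1 * (nth (0, 0) s (sigma j)).1).

(* iota_K L for K of degree dK, summed over the arities k of K; the component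
   of L involved has arity (size s - k) + 1 >= 1. *)
Definition iotaRN (dK : int) (K L : vform) : vform := fun s =>
  \sum_(k < (size s).+1) \sum_(sigma : 'S_(size s) | unshuffle k sigma)
    koszul sigma *:
      let t := permute sigma in
      L ((degsum (take k t) + dK, K (take k t)) :: drop k t).

(* [K,L]_RN for K of degree dK and L of degree dL *)
Definition RN (dK dL : int) (K L : vform) : vform := fun s =>
  iotaRN dK K L s - ((-1 : R) ^ (dK * dL)) *: iotaRN dL L K s.

Definition vform_add (K L : vform) : vform := fun s => K s + L s.

Definition vform1 (D : E -> E) : vform :=
  fun s => if s is [:: x] then D x.2 else 0.

Definition vform2 (B : E -> E -> E) : vform :=
  fun s => if s is [:: x; y] then B x.2 y.2 else 0.

(* [NN] is Nijenhuis with respect to [mu], with square [KK]. *)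
Definition nijenhuis_form (mu NN KK : vform) : Prop :=
  [/\ sym_vform 1 mu, sym_vform 0 NN, sym_vform 0 KK &
      forall s, homogeneous s ->
        RN 0 1 NN (RN 0 1 NN mu) s = RN 0 1 KK mu s /\ RN 0 0 NN KK s = 0].

End VectorValuedForms.

(* l_2(P,Q) = (-1)^(p-1) [P,Q]_SN; a P in Gamma(/\^p A) has degree p - 2. *)
Definition l2 (R : realType) (E : lmodType R) (SN : E -> E -> E) : vform E :=
  fun s => if s is [:: x; y] then ((-1 : R) ^ (x.1 + 2 - 1)) *: SN x.2 y.2
           else 0.

(* Main.v *)
Require Import Defs.
From mathcomp Require Import all_boot all_order all_fingroup all_algebra.
From mathcomp Require Import all_classical all_reals all_analysis.
From mathcomp Require Import ring lra zify.

Set Implicit Arguments.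
Unset Strict Implicit.
Unset Printing Implicit Defensive.

Import Order.TTheory GRing.Theory Num.Theory.
Import numFieldNormedType.Exports.

Local Open Scope classical_set_scope.
Local Open Scope ring_scope.

(* Every vector valued form involved is a multiderivation of the wedge product, and
  so is the Richardson-Nijenhuis bracket of two such forms: fixing all arguments
  but the last one, the bracket becomes a sum of graded commutators of derivations
  and of derivations.  A graded symmetric multiderivation vanishes as soon as it
  does on functions and sections of A, for, locally, a smooth bump function turns
  any multivector field into a combination of products of global sections.  On
  functions and sections, mostly for degree reasons, the identities to check are:
  2 T_N = 0 for the component of arity 2 (T_N is the torsion of N); d alpha = 0,
  d alpha_N = 0, and
    d alpha (NX,Y,Z) + d alpha (X,NY,Z) + d alpha (X,Y,NZ) - 2 d alpha_N (X,Y,Z) = 0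
  for the one of arity 3.  The component of arity 4 is zero because
  [ualpha, l2]_RN is. *)

(** * Smooth functions *)

Section SmoothCalculus.
Context {R : realType} {n : nat}.
Implicit Types (f g h : 'rV[R]_n -> R) (U : set 'rV[R]_n).

(** The extensions and the Schouten bracket are known only through axioms on smooth arguments, with
    explicit values on functions, sections or products of global sections, whereas an expression in
    a frame is only local. What bridges the gap is that a derivation which kills the functions is
    linear over them: multiplying its argument by a function equal to 1 at a point does not change
    its value there. The degree count is uniform. Generators have degree -2 (functions) or -1
    (sections), and nonzero elements have degree at least -2. Hence a form of degree $d$ and arity
    $k$ vanishes on generators unless $k$ plus the number of functions among them is at most $d +
    2$. Since $[\underline\alpha, l_2]_{RN} = 0$, the inner bracket of the Nijenhuis condition is $T
    = [\underline N, l_2]_{RN}$, of arity 2 only. The condition then splits into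
    $[\underline N, T]_{RN} = [\underline{N^2}, l_2]_{RN}$, $[\underline\alpha, T]_{RN} = 0$ and
    $[\underline{\alpha_N}, l_2]_{RN} = 0$. *)

Lemma differentiable_near_eq (V W : normedModType R) (f g : V -> W) (x : V) :
  (\near x, f x = g x) -> differentiable f x -> differentiable g x.
Proof.
move=> fg df; have [dc dE] := (diff_locallyP x f).1 df.
have gE : g \o shift x = cst (g x) + 'd f x +o_ 0 id.
  apply/eqaddoP => _/posnumP[eps].
  move: (dE) => /eqaddoP /(_ eps%:num (gt0 eps)) H.
  have K : \forall h \near (0 : V), f (h + x) = g (h + x).
    by move: fg; rewrite (near_shift 0) /= ; apply: filterS => h /=; rewrite subr0.
  have gx : f x = g x := nbhs_singleton fg.
  by apply: filterS2 K H => h /= E; rewrite !fctE /= -E -gx.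
have E := diff_unique dc gE.
by apply/diff_locallyP; rewrite E.
Qed.

Lemma Ck_onW k U f : Ck_on k.+1 U f -> Ck_on k U f.
Proof.
elim: k f => [|k IH] f [df dD].
  by move=> x /df /differentiable_continuous.
by split=> // v; apply: IH; exact: dD.
Qed.

Lemma Ck_onS k (U V : set 'rV[R]_n) f : U `<=` V -> Ck_on k V f -> Ck_on k U f.
Proof.
move=> UV; elim: k f => [|k IH] f.
  by move=> cf x /UV; exact: cf.
by case=> df dD; split=> [x /UV|v]; [exact: df|apply: IH; exact: dD].
Qed.

Lemma Ck_onU k (U V : set 'rV[R]_n) f :
  Ck_on k U f -> Ck_on k V f -> Ck_on k (U `|` V) f.
Proof.
elim: k f => [|k IH] f.
  by move=> cf cg x [/cf|/cg].
by case=> df dD [dg dE]; split=> [x [/df|/dg]|v] //; apply: IH; [exact: dD|exact: dE].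
Qed.

Lemma near_of_open (T : topologicalType) (U : set T) (P : T -> Prop) (x : T) :
  open U -> U x -> (forall y, U y -> P y) -> \forall y \near x, P y.
Proof.
move=> oU Ux UP; have : nbhs x U by exact: open_nbhs_nbhs.
by apply: filterS.
Qed.

Lemma Ck_on_eq k U f g : open U -> (forall x, U x -> f x = g x) ->
  Ck_on k U f -> Ck_on k U g.
Proof.
move=> oU; elim: k f g => [|k IH] f g fg.
  move=> cf x Ux; have := cf x Ux; rewrite /prop_for /continuous_at (fg x Ux).
  apply: cvg_trans; apply: (@near_eq_cvg _ _ (nbhs x)).
  by apply: near_of_open oU Ux _ => y Uy; rewrite fg.
case=> df dD; split=> [x Ux|v].
  by apply: differentiable_near_eq (df x Ux); exact: near_of_open oU Ux _.
apply: IH (dD v) => x Ux.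
by apply: near_eq_derive; exact: near_of_open oU Ux _.
Qed.

Lemma Ck_on_cst k U (c : R) : open U -> Ck_on k U (cst c).
Proof.
move=> oU; elim: k c => [|k IH] c; first by move=> x _; exact: cst_continuous.
split=> [x _|v]; first exact: differentiable_cst.
by apply: Ck_on_eq oU _ (IH 0) => x Ux; rewrite derive_cst.
Qed.

Lemma Ck_onD k U f g : open U -> Ck_on k U f -> Ck_on k U g ->
  Ck_on k U (fun x => f x + g x).
Proof.
move=> oU; elim: k f g => [|k IH] f g.
  by move=> cf cg x Ux; exact: (cvgD (cf x Ux) (cg x Ux)).
case=> df dD [dg dE]; split=> [x Ux|v].
  by apply: differentiableD; [exact: df|exact: dg].
apply: Ck_on_eq oU _ (IH _ _ (dD v) (dE v)) => x Ux.
by rewrite -deriveD //; apply: diff_derivable; [exact: df|exact: dg].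
Qed.

Lemma Ck_onM k U f g : open U -> Ck_on k U f -> Ck_on k U g ->
  Ck_on k U (fun x => f x * g x).
Proof.
move=> oU; elim: k f g => [|k IH] f g.
  by move=> cf cg x Ux; exact: (cvgM (cf x Ux) (cg x Ux)).
move=> Cf Cg; have [df dD] := Cf; have [dg dE] := Cg; split=> [x Ux|v].
  by apply: differentiableM; [exact: df|exact: dg].
have H := Ck_onD oU (IH _ _ (Ck_onW Cf) (dE v)) (IH _ _ (Ck_onW Cg) (dD v)).
apply: Ck_on_eq oU _ H => x Ux.
by rewrite -[RHS]/('D_v (f * g) x) deriveM //; apply: diff_derivable; [exact: df|exact: dg].
Qed.

Lemma smooth_onS (U V : set 'rV[R]_n) f :
  U `<=` V -> smooth_on V f -> smooth_on U f.
Proof. by move=> UV Vf k; exact: Ck_onS (Vf k). Qed.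

Lemma smooth_onU (U V : set 'rV[R]_n) f :
  smooth_on U f -> smooth_on V f -> smooth_on (U `|` V) f.
Proof. by move=> Uf Vf k; exact: Ck_onU. Qed.

Lemma smooth_on_eq U f g : open U -> (forall x, U x -> f x = g x) ->
  smooth_on U f -> smooth_on U g.
Proof. by move=> oU fg Uf k; exact: Ck_on_eq (Uf k). Qed.

Lemma smooth_on_cst U (c : R) : open U -> smooth_on U (cst c).
Proof. by move=> oU k; exact: Ck_on_cst. Qed.

Lemma smooth_onD U f g : open U -> smooth_on U f -> smooth_on U g ->
  smooth_on U (fun x => f x + g x).
Proof. by move=> oU Uf Ug k; exact: Ck_onD. Qed.

Lemma smooth_onM U f g : open U -> smooth_on U f -> smooth_on U g ->
  smooth_on U (fun x => f x * g x).
Proof. by move=> oU Uf Ug k; exact: Ck_onM. Qed.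

End SmoothCalculus.

(** * Flat functions of one variable *)

Section FlatFunction.
Context {R : realType}.

(* All the derivatives of [flat 0] are combinations of the functions [flat m]. *)
Definition flat (m : nat) (t : R) : R :=
  if 0 < t then t^-1 ^+ m * expR (- t^-1) else 0.

Lemma flat_ge0 m t : 0 <= flat m t.
Proof.
by rewrite /flat; case: ifP => // t0; rewrite mulr_ge0 ?expR_ge0 ?exprn_ge0 ?invr_ge0 ?ltW.
Qed.

(** The exponential dominates the term of degree [m.+2] of its series at [t^-1]. The bound is
    quadratic so that the difference quotient of [flat m] at 0 tends to 0. *)
Lemma flat_le m t : flat m t <= (m.+2)`!%:R * t ^+ 2.
Proof.
rewrite /flat; case: ifP => [t0|_]; last by rewrite mulr_ge0 ?sqr_ge0.
have u0 : 0 < t^-1 by rewrite invr_gt0.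
have := @expR_ge1Dxn R t^-1 m.+1 (ltW u0).
rewrite expRN => E.
have F0 : 0 < (m.+2)`!%:R :> R by rewrite ltr0n fact_gt0.
have E2 : t^-1 ^+ m.+2 <= (m.+2)`!%:R * expR t^-1.
  rewrite mulrC -ler_pdivrMr //; apply: le_trans E.
  by rewrite lerDr.
rewrite ler_pdivrMr ?expR_gt0 //.
have -> : t^-1 ^+ m = t^-1 ^+ m.+2 * t ^+ 2.
  by rewrite -addn2 exprD -mulrA -exprMn mulVf ?gt_eqF // expr1n mulr1.
by rewrite [leRHS]mulrAC ler_wpM2r ?sqr_ge0.
Qed.

Lemma is_derive_flat m (t : R) :
  is_derive t 1 (flat m) (flat m.+2 t - m%:R * flat m.+1 t).
Proof.
have [t0|t0|<-] := ltgtP 0 t; last first.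
- have -> : flat m.+2 (0:R) - m%:R * flat m.+1 (0:R) = 0.
    by rewrite /flat ltxx mulr0 subrr.
  (* By [flat_le], the difference quotient is at most a constant times [|h|]. *)
  have F : (fun h : R => h^-1 *: (flat m (h *: 1 + 0) - flat m 0)) @ 0^' --> (0 : R).
    have Z : (fun h : R => (m.+2)`!%:R * `|h|) @ 0^' --> (0 : R).
      have N : (fun h : R => `|h|) @ 0^' --> (0 : R).
        by rewrite -[X in _ --> X](normr0 R); apply: cvg_norm; exact: nbhs_dnbhs.
      by rewrite -[X in _ --> X](mulr0 ((m.+2)`!%:R)); exact: (cvgM (cvg_cst _) N).
    apply/cvgr0Pnorm_le => e e0.
    move/cvgr0Pnorm_le: Z => /(_ e e0); apply: filterS => h.
    apply: le_trans; rewrite !scaler1 addr0 {2}/flat ltxx subr0.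
    rewrite normrZ normfV (ger0_norm (flat_ge0 _ _)).
    rewrite (ger0_norm (mulr_ge0 _ _)) //.
    have [->|h0] := eqVneq h 0; first by rewrite normr0 invr0 mul0r mulr0.
    rewrite mulrC ler_pdivrMr ?normr_gt0 //.
    by apply: le_trans (flat_le m h) _; rewrite -mulrA -expr2 real_normK ?num_real.
  apply: DeriveDef; first by apply/cvg_ex; exists 0.
  exact: cvg_lim F.
- have -> : flat m.+2 t - m%:R * flat m.+1 t = 0.
    by rewrite /flat !ltNge (ltW t0) /= mulr0 subrr.
  have D : is_derive t 1 (cst (0 : R) : R -> R) (0 : R) by exact: is_derive_cst.
  apply: near_eq_is_derive D; near=> u; rewrite /flat ltNge /cst /=.
  have -> // : u <= 0.
  by apply: ltW; near: u; exact: lt_nbhsl.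
- have dV : is_derive t 1 (fun u : R => u^-1) (- t ^- 2).
    by apply: DeriveDef; [apply: derivableV; rewrite ?gt_eqF|rewrite deriveV ?gt_eqF // derive_id scaler1].
  have dX := @is_deriveX R R _ m t 1 _ dV.
  have dE := @is_derive1_comp R expR (fun u => - u^-1) t _ _ (is_derive_expR _) (is_deriveN dV).
  have D := is_deriveM dX dE.
  apply: (@is_derive_eq _ _ _ _ _ _ _ _ (near_eq_is_derive _ D)).
    near=> u; rewrite /flat.
    have -> : 0 < u by near: u; exact: lt_nbhsr.
    by rewrite !fctE.
  rewrite /flat t0 /= !fctE; case: m {dX D} => [|m].
    rewrite expr0 /= mul0r; move: (expR _) => e.
    by rewrite /GRing.scale /=; field; rewrite gt_eqF.
  rewrite /= !exprS; move: (expR _) => e.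
  by rewrite /GRing.scale /=; field; rewrite gt_eqF.
Unshelve. all: by end_near.
Qed.
End FlatFunction.

Section SmoothFlat.
Context {R : realType} {n : nat}.
Implicit Types (U : set 'rV[R]_n) (h : 'rV[R]_n -> R).

Lemma derive_flat_comp m h (x v : 'rV[R]_n) : differentiable h x ->
  differentiable (flat m \o h) x /\
  'D_v (flat m \o h) x =
    (flat m.+2 (h x) + (- m%:R) * flat m.+1 (h x)) * 'D_v h x.
Proof.
move=> dh; have D := is_derive_flat m (h x).
have dF : differentiable (flat m : R -> R) (h x).
  by apply/derivable1_diffP; exact: ex_derive.
split; first exact: differentiable_comp.
rewrite (deriveE _ (differentiable_comp dh dF)) (deriveE _ dh) diff_comp //=.
have E : 'd (flat m) (h x) 1 = flat m.+2 (h x) + - m%:R * flat m.+1 (h x).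
  by rewrite -deriveE // derive_val mulNr.
rewrite -E; set y := 'd h x v.
by rewrite -[in LHS](mulr1 y) -[y * 1]/(y *: (1 : R^o)) linearZ /= mulrC.
Qed.

(** Induction on the order of differentiability for all [m] at once, since a derivative of [flat m]
    involves [flat m.+1] and [flat m.+2]. *)
Lemma smooth_on_flat m U h : open U -> smooth_on U h ->
  smooth_on U (fun x => flat m (h x)).
Proof.
move=> oU sh k; elim: k m => [|k IH] m.
  move=> x Ux; have [dh _] := sh 1%N.
  exact: differentiable_continuous (derive_flat_comp m 0 (dh x Ux)).1.
have [dh _] := sh 1%N; split=> [x Ux|v].
  exact: (derive_flat_comp m 0 (dh x Ux)).1.
have sD : Ck_on k U (fun x => 'D_v h x) by case: (sh k.+1) => _ /(_ v).
have H := Ck_onM oU (Ck_onD oU (IH m.+2) (Ck_onM oU (Ck_on_cst k (- m%:R) oU) (IH m.+1))) sD.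
apply: Ck_on_eq oU _ H => x Ux.
by rewrite (derive_flat_comp m v (dh x Ux)).2.
Qed.

End SmoothFlat.

(** * Smooth functions on a manifold, bump functions *)

Section SmoothFunctions.
Context {R : realType} {n : nat} {M : manifold R n}.
Implicit Types (U V W : set M) (f g : M -> R).

(** Inside the open image of the chart, this image is the preimage of [U] by [chart_inv i], which is
    continuous there. *)
Lemma chart_open (i : chart_index M) U :
  open U -> open (chart i @` (chart_dom i `&` U)).
Proof.
move=> oU.
have := @chart_inv_continuous _ _ M i; rewrite continuous_open_subspace; last exact: chart_im_open.
move=> ci.
have -> : chart i @` (chart_dom i `&` U) =
   (chart i @` chart_dom i) `&` (chart_inv i @^-1` U).
  apply/seteqP; split=> y /=.
    by case=> x [Dx Ux] <-; split; [exists x|rewrite chartK].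
  by case=> -[x Dx <-]; rewrite chartK // => Ux; exists x.
rewrite openE => y [yi yU]; apply: filterI.
  exact: (open_nbhs_nbhs (conj (@chart_im_open _ _ M i) yi)).
apply: ci; first by rewrite inE.
exact: (open_nbhs_nbhs (conj oU yU)).
Qed.

Lemma smooth_funS U V f : U `<=` V -> smooth_fun V f -> smooth_fun U f.
Proof.
move=> UV sf i; apply: smooth_onS (sf i).
by apply: image_subset; exact: setIS.
Qed.

Lemma smooth_funU U V f :
  smooth_fun U f -> smooth_fun V f -> smooth_fun (U `|` V) f.
Proof.
move=> sU sV i; apply: smooth_onS (smooth_onU (sU i) (sV i)).
by rewrite setIUr image_setU.
Qed.

Lemma smooth_fun_eq U f g : open U -> (forall x, U x -> f x = g x) ->
  smooth_fun U f -> smooth_fun U g.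
Proof.
move=> oU fg sf i; apply: smooth_on_eq (chart_open oU) _ (sf i).
by move=> _ [x [Dx Ux] <-]; rewrite chartK // fg.
Qed.

Lemma smooth_fun_cst U (c : R) : open U -> smooth_fun U (fun=> c).
Proof. by move=> oU i; exact: smooth_on_cst (chart_open oU). Qed.

Lemma smooth_funD U f g : open U -> smooth_fun U f -> smooth_fun U g ->
  smooth_fun U (fun x => f x + g x).
Proof. by move=> oU sf sg i; exact: smooth_onD (chart_open oU) (sf i) (sg i). Qed.

Lemma smooth_funM U f g : open U -> smooth_fun U f -> smooth_fun U g ->
  smooth_fun U (fun x => f x * g x).
Proof. by move=> oU sf sg i; exact: smooth_onM (chart_open oU) (sf i) (sg i). Qed.

Lemma smooth_fun_sum U (I : Type) (s : seq I) (P : pred I) (F : I -> M -> R) :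
  open U -> (forall i, P i -> smooth_fun U (F i)) ->
  smooth_fun U (fun x => \sum_(i <- s | P i) F i x).
Proof.
move=> oU sF; elim: s => [|i s IH].
  by apply: smooth_fun_eq oU _ (smooth_fun_cst 0 oU) => x _; rewrite big_nil.
have [Pi|nPi] := boolP (P i); last first.
  by apply: smooth_fun_eq oU _ IH => x _; rewrite big_cons (negPf nPi).
apply: smooth_fun_eq oU _ (smooth_funD oU (sF i Pi) IH) => x _.
by rewrite big_cons Pi.
Qed.

Lemma smooth_fun_prod U (I : Type) (s : seq I) (F : I -> M -> R) :
  open U -> (forall i, smooth_fun U (F i)) ->
  smooth_fun U (fun x => \prod_(i <- s) F i x).
Proof.
move=> oU sF; elim: s => [|i s IH].
  by apply: smooth_fun_eq oU _ (smooth_fun_cst 1 oU) => x _; rewrite big_nil.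
apply: smooth_fun_eq oU _ (smooth_funM oU (sF i) IH) => x _.
by rewrite big_cons.
Qed.

Lemma smooth_fun_flat U m f : open U -> smooth_fun U f ->
  smooth_fun U (fun x => flat m (f x)).
Proof. by move=> oU sf i; exact: smooth_on_flat (chart_open oU) (sf i). Qed.

(** The derivatives in [Ck_on] are those of the total function, so that each of its conditions bears
    on one point at a time: [Ck_on] can be tested on singletons. *)
Lemma smooth_fun_cover (I : Type) (D : I -> set M) U f :
  (forall i, open (D i)) -> (forall x, U x -> exists i, D i x) ->
  (forall i, smooth_fun (D i `&` U) f) -> smooth_fun U f.
Proof.
move=> oD cD sf i k.
suff H : forall x, U x -> chart_dom i x -> Ck_on k [set chart i x] (f \o chart_inv i).
  have P : forall (S : set 'rV[R]_n) (g : 'rV[R]_n -> R), (forall y, S y -> Ck_on k [set y] g) -> Ck_on k S g.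
    elim: k {H} => [|k IH] S g H; first by move=> y Sy; exact: (H y Sy y).
    split=> [y Sy|v]; first exact: (H y Sy).1.
    by apply: IH => y Sy; exact: (H y Sy).2.
  by apply: P => _ [x [Dx Ux] <-]; exact: H.
move=> x Ux Dx; have [j Djx] := cD x Ux.
by apply: Ck_onS (sf j i k) => _ ->; exists x.
Qed.

Lemma smooth_fun_coord i (k : 'I_n) :
  smooth_fun (chart_dom i) (fun x => chart (m := M) i x ord0 k).
Proof. by move=> j; rewrite setIC; have := @chart_transition _ _ M j i k; rewrite setIC. Qed.

(** In a chart, a product over the coordinates of flat functions of $\rho^2 - (y_k - a_k)^2$,
    supported in a compact box, extended by zero. The open set [W] records that [b] is supported in
    [U], in a form suited to gluing along the cover by [U] and [W]. *)
Lemma bump_function U (x : M) : open U -> U x ->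
  exists (b : M -> R) (W : set M),
    [/\ Cinf b, b x = 1, open W, (forall y, W y -> b y = 0) & U `|` W = setT].
Proof.
move=> oU Ux; have [i Dx] := chart_cover x.
pose a := chart i x.
have nA : nbhs a (chart i @` (chart_dom i `&` U)).
  by apply: open_nbhs_nbhs; split; [exact: chart_open|exists x].
move: nA => /nbhs_ballP [e /= e0 Be].
(* Half the radius, so that the closed box still lies in the open ball, hence in the image of the
   chart. *)
pose rho := e / 2; have rho0 : 0 < rho by rewrite divr_gt0.
pose box := [set y : 'rV[R]_n | forall k, `[a ord0 k - rho, a ord0 k + rho]%classic (y ord0 k)].
have boxA : box `<=` chart i @` (chart_dom i `&` U).
  move=> y yb; apply: Be; split=> // k k'; rewrite !ord1.
  have := yb k'; rewrite /= in_itv /= -ler_distl distrC => H.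
  by apply: le_lt_trans H _; rewrite ltr_pdivrMr // ltr_pMr // ltr1n.
have cbox : compact box.
  exact: (@rV_compact R n (fun k => `[a ord0 k - rho, a ord0 k + rho]%classic)
                      (fun k => @segment_compact R _ _)).
pose K := chart_inv i @` box.
have cK : compact K.
  apply: continuous_compact cbox.
  apply: continuous_subspaceW (@chart_inv_continuous _ _ M i).
  by move=> y /boxA [z [Dz _] <-]; exists z.
(* The Hausdorff axiom serves here: the complement of [K] is open, and the extension by zero is
   smooth on it. *)
have clK : closed K by apply: compact_closed cK; exact: manifold_hausdorff.
have KU : K `<=` U by move=> _ [y /boxA [z [Dz Uz] <-] <-]; rewrite chartK.
(* The value of each flat factor at the centre of the box; dividing by it gives [b x = 1]. *)
pose c := flat 0 (rho ^+ 2).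
have c0 : c != 0.
  by rewrite /c /flat exprn_gt0 // expr0 mul1r gt_eqF // expR_gt0.
pose b (y : M) := \prod_(k < n) (c^-1 * flat 0 (rho ^+ 2 + -1 *
  ((chart i y ord0 k + - a ord0 k) * (chart i y ord0 k + - a ord0 k)))).
(* The chart is a total map with arbitrary values off its domain, hence the truncation. *)
pose b' (y : M) := if `[< chart_dom i y >] then b y else 0.
have b'0 : forall y, (~` K) y -> b' y = 0.
  move=> y nKy; rewrite /b'; case: asboolP => // Dy; apply/eqP/prodf_eq0.
  have : ~ box (chart i y) by move=> yb; apply: nKy; exists (chart i y) => //; rewrite chartK.
  move=> /existsNP [k nk]; exists k => //; apply/eqP.
  rewrite /flat ifF ?mulr0 //; apply/negbTE; rewrite -leNgt mulN1r subr_le0 -expr2.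
  have /negP : ~ (`|chart i y ord0 k - a ord0 k| <= rho).
    by rewrite ler_distl => H; apply: nk; rewrite /= in_itv.
  rewrite -ltNge => /ltW H; rewrite -[leRHS]real_normK ?num_real //.
  by rewrite lerXn2r // nnegrE ?ltW.
have oD := @chart_dom_open _ _ M i.
have oK : open (~` K) by rewrite openC.
exists b', (~` K); split=> //.
- rewrite /Cinf; have -> : setT = chart_dom i `|` (~` K).
    apply/esym/seteqP; split=> // y _; have [|nD] := pselect (chart_dom i y); first by left.
    by right=> -[z /boxA [w [Dw _] <-]]; rewrite chartK // => E; apply: nD; rewrite -E.
  apply: smooth_funU; last first.
    by apply: smooth_fun_eq oK _ (smooth_fun_cst 0 oK) => y /b'0.
  apply: (@smooth_fun_eq _ b) => //; first by move=> y Dy; rewrite /b' asboolT.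
  apply: smooth_fun_prod => // k; apply: smooth_funM => //; first exact: smooth_fun_cst.
  apply: smooth_fun_flat => //; apply: smooth_funD => //; first exact: smooth_fun_cst.
  apply: smooth_funM => //; first exact: smooth_fun_cst.
  have sk : smooth_fun (chart_dom i) (fun y => chart i y ord0 k + - a ord0 k).
    by apply: smooth_funD => //; [exact: smooth_fun_coord|exact: smooth_fun_cst].
  exact: smooth_funM.
- rewrite /b' asboolT // /b big1 // => k _.
  by rewrite -/a subrr mulr0 mulr0 addr0 mulVf.
- by apply/seteqP; split=> // y _; have [/KU|] := pselect (K y); [left|right].
Qed.

End SmoothFunctions.

(** * The exterior algebra *)

Section ExteriorAlgebra.
Local Close Scope classical_set_scope.
Import mathcomp.boot.finset.
Context {R : realType} {r : nat}.
Implicit Types (a b c : ext R r) (S T U : {set 'I_r}).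

Lemma inversionsE S T :
  inversions S T = (\sum_(i in S) \sum_(j in T) (j < i)%N)%N.
Proof.
rewrite /inversions -sum1_card.
rewrite (eq_bigl (fun p : 'I_r * 'I_r => (p.1 \in S) && ((p.2 \in T) && (p.2 < p.1)%N))); last first.
  by move=> p; rewrite inE.
rewrite -(pair_big_dep (mem S) (fun i j : 'I_r => (j \in T) && (j < i)%N) (fun _ _ => 1%N)) /=.
by apply: eq_bigr => i _; rewrite -big_mkcondr; apply: eq_bigr.
Qed.

Lemma big_setU_disj S S' (F : 'I_r -> nat) : [disjoint S & S'] ->
  (\sum_(i in S :|: S') F i = \sum_(i in S) F i + \sum_(i in S') F i)%N.
Proof. by move=> d; rewrite -bigU //=; apply: eq_bigl => i; rewrite !inE. Qed.

Lemma inversionsUl S S' T : [disjoint S & S'] ->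
  inversions (S :|: S') T = (inversions S T + inversions S' T)%N.
Proof. by move=> d; rewrite !inversionsE (big_setU_disj _ d). Qed.

Lemma inversionsUr S T T' : [disjoint T & T'] ->
  inversions S (T :|: T') = (inversions S T + inversions S T')%N.
Proof.
move=> d; rewrite !inversionsE -big_split; apply: eq_bigr => i _.
by rewrite (big_setU_disj _ d).
Qed.

(** Each pair in the product of [S] and [T] is an inversion in exactly one of the two orders. This
    is the source of the sign of graded commutativity. *)
Lemma inversions_sym S T : [disjoint S & T] ->
  (inversions S T + inversions T S = #|S| * #|T|)%N.
Proof.
move=> d; rewrite !inversionsE [X in (_ + X)%N]exchange_big -big_split /=.
rewrite -sum_nat_const; apply: eq_bigr => i iS; rewrite -big_split /=.
rewrite -[RHS]sum1_card; apply: eq_bigr => j jT.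
have : i != j by apply: contraTneq jT => <-; rewrite (disjointFr d).
by rewrite -val_eqE /=; case: ltngtP.
Qed.

Lemma extmulDl a b c : extmul (a + b) c = extmul a c + extmul b c.
Proof.
apply/ffunP => U; rewrite !ffunE -big_split /=; apply: eq_bigr => S _.
by rewrite ffunE mulrDr mulrDl.
Qed.

Lemma extmulDr a b c : extmul a (b + c) = extmul a b + extmul a c.
Proof.
apply/ffunP => U; rewrite !ffunE -big_split /=; apply: eq_bigr => S _.
by rewrite ffunE mulrDr.
Qed.

Lemma extmulZl (k : R) a b : extmul (k *: a) b = k *: extmul a b.
Proof.
apply/ffunP => U; rewrite !ffunE [RHS]big_distrr /=; apply: eq_bigr => S _.
by rewrite ffunE /GRing.scale /=; ring.
Qed.

Lemma extmulZr (k : R) a b : extmul a (k *: b) = k *: extmul a b.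
Proof.
apply/ffunP => U; rewrite !ffunE [RHS]big_distrr /=; apply: eq_bigr => S _.
by rewrite ffunE /GRing.scale /=; ring.
Qed.

Lemma extmul0l a : extmul 0 a = 0.
Proof. by rewrite -[X in extmul X _](scale0r 0) extmulZl scale0r. Qed.

Lemma extmul0r a : extmul a 0 = 0.
Proof. by rewrite -[X in extmul _ X](scale0r 0) extmulZr scale0r. Qed.

Lemma extmulNl a b : extmul (- a) b = - extmul a b.
Proof. by rewrite -scaleN1r extmulZl scaleN1r. Qed.

Lemma extmul_suml (I : Type) (s : seq I) (P : pred I) (F : I -> ext R r) b :
  extmul (\sum_(i <- s | P i) F i) b = \sum_(i <- s | P i) extmul (F i) b.
Proof. by apply: (big_morph (fun a => extmul a b)) => [a c|]; [exact: extmulDl|exact: extmul0l]. Qed.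

Lemma extmul_sumr (I : Type) (s : seq I) (P : pred I) (F : I -> ext R r) a :
  extmul a (\sum_(i <- s | P i) F i) = \sum_(i <- s | P i) extmul a (F i).
Proof. by apply: (big_morph (fun b => extmul a b)) => [b c|]; [exact: extmulDr|exact: extmul0r]. Qed.

Lemma extmul1l a : extmul (ext1 R r) a = a.
Proof.
apply/ffunP => U; rewrite ffunE (bigD1 set0) ?sub0set //= big1 ?addr0.
  by rewrite ffunE eqxx mulr1 setD0 inversionsE big_set0 expr0 mul1r.
by move=> S /andP[_ S0]; rewrite ffunE (negPf S0) mulr0 mul0r.
Qed.

Lemma extmul1r a : extmul a (ext1 R r) = a.
Proof.
apply/ffunP => U; rewrite ffunE (bigD1 U) //= big1 ?addr0.
  rewrite setDv ffunE eqxx mulr1 inversionsE big1 ?expr0 ?mul1r // => i _.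
  by rewrite big_set0.
move=> S /andP[SU nSU]; rewrite [ext1 _ _ _]ffunE setD_eq0.
by rewrite (_ : (U \subset S) = false) ?mulr0 //; apply: contraNF nSU => US; rewrite eqEsubset SU.
Qed.

(** Both sides are sums over the splittings of [U] into three disjoint sets [S], [W], [T]: the flag
    $S \subset V \subset U$ on the right is reindexed by $V = S \cup W$. The signs agree because
    [inversions] is additive in each argument. *)
Lemma extmulA a b c : extmul a (extmul b c) = extmul (extmul a b) c.
Proof.
apply/ffunP => U; rewrite !ffunE.
under [RHS]eq_bigr => V VU do rewrite ffunE big_distrr big_distrl /=.
rewrite (exchange_big_dep (fun S => S \subset U)) /=; last first.
  by move=> V S VU SV; exact: fintype.subset_trans SV VU.
apply: eq_bigr => S SU; rewrite ffunE big_distrr /=.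
rewrite [RHS](reindex_onto (fun W => S :|: W) (fun V => V :\: S)) /=; last first.
  by move=> V /andP[_ SV]; apply/setP => i; rewrite !inE; have := fintype.subsetP SV i; case: (i \in S) => // ->.
have dom W : [&& S :|: W \subset U, S \subset S :|: W & (S :|: W) :\: S == W]
              = (W \subset U :\: S).
  rewrite subUset SU subsetUl setDUl setDv set0U /=.
  by rewrite subsetD (sameP eqP setDidPl).
under [RHS]eq_bigl => W do rewrite -andbA dom.
apply: eq_bigr => W WUS.
have dSW : [disjoint S & W].
  by rewrite disjoint_sym; move: WUS; rewrite subsetD => /andP[].
have WU : W \subset U by move: WUS; rewrite subsetD => /andP[].
have E1 : ((S :|: W) :\: S) = W.
  rewrite setDUl setDv set0U; apply/setDidPl.
  by rewrite disjoint_sym.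
have E2 : (U :\: (S :|: W) = (U :\: S) :\: W) by rewrite setDDl.
rewrite E1 E2; set T := ((U :\: S) :\: W).
have dWT : [disjoint W & T] by rewrite disjoints_subset subsetC subsetDr.
have E3 : (U :\: S = W :|: T).
  by rewrite /T; apply/setP => i; rewrite !inE; have := fintype.subsetP WUS i; rewrite !inE; case: (i \in W) => //= ->.
rewrite {1}E3 inversionsUr // inversionsUl // !exprD; ring.
Qed.

Definition exthom (p : nat) a := forall S, a S != 0 -> #|S| = p.

Lemma exthom_mul p q a b : exthom p a -> exthom q b -> exthom (p + q) (extmul a b).
Proof.
move=> ha hb U; apply: contraNeq => nU; rewrite ffunE big1 // => S SU.
apply/eqP; apply: contra_neqT nU => nz.
have : (a S != 0) && (b (U :\: S) != 0).
  by apply: contraNT nz; rewrite negb_and !negbK => /orP[] /eqP ->; rewrite ?mulr0 ?mul0r.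
move=> /andP[/ha <- /hb <-]; rewrite cardsDS // subnKC //.
exact: subset_leq_card.
Qed.

(** Complementation in [U] exchanges the two sums, and [inversions_sym] gives the sign. *)
Lemma extmulC p q a b : exthom p a -> exthom q b ->
  extmul a b = (-1) ^+ (p * q) *: extmul b a.
Proof.
move=> ha hb; apply/ffunP => U; rewrite !ffunE [RHS]big_distrr /=.
rewrite [RHS](reindex_onto (fun S => U :\: S) (fun S => U :\: S)) /=; last first.
  by move=> S SU; rewrite setDDr setDv set0U; apply/setIidPr.
apply: eq_big => S.
  rewrite subsetDl setDDr setDv set0U /=; apply/idP/eqP => [/setIidPr//|<-].
  by rewrite subsetIl.
move=> SU; have -> : (U :\: (U :\: S) = S).
  by rewrite setDDr setDv set0U; apply/setIidPr.
have [a0|/ha pE] := eqVneq (a S) 0; first by rewrite a0 !(mulr0, mul0r).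
have [b0|/hb qE] := eqVneq (b (U :\: S)) 0; first by rewrite b0 !(mulr0, mul0r).
have d : [disjoint S & U :\: S] by rewrite disjoints_subset subsetC subsetDr.
rewrite -pE -qE -(inversions_sym d) exprD.
set x := (-1) ^+ _; set y := (-1) ^+ _.
have yy : y * y = 1 by rewrite /y -expr2 sqrr_sign.
by rewrite -!mulrA; rewrite (mulrCA y) (mulrA y y) yy; ring.
Qed.

Lemma exthom_vec (v : 'rV[R]_r) : exthom 1 (extvec v).
Proof.
move=> S; apply: contraNeq => nS; rewrite ffunE big1 // => i /eqP E.
by move: nS; rewrite E cards1 eqxx.
Qed.

Lemma exthom1 : exthom 0 (ext1 R r).
Proof.
move=> S; rewrite ffunE; have [->|_] := eqVneq S set0; first by rewrite cards0.
by rewrite eqxx.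
Qed.

Lemma extmul_vecC (v w : 'rV[R]_r) :
  extmul (extvec v) (extvec w) = - extmul (extvec w) (extvec v).
Proof. by rewrite (extmulC (@exthom_vec v) (@exthom_vec w)) expr1 scaleN1r. Qed.

Lemma extmul_vecK (v : 'rV[R]_r) : extmul (extvec v) (extvec v) = 0.
Proof.
have := extmul_vecC v v; move: (extmul _ _) => a E.
apply/ffunP => S; move/ffunP/(_ S): E; rewrite !ffunE => E; lra.
Qed.

Lemma extvecD (v w : 'rV[R]_r) : extvec (v + w) = extvec v + extvec w.
Proof.
by apply/ffunP => S; rewrite !ffunE -big_split; apply: eq_bigr => i _; rewrite mxE.
Qed.

Lemma extvecZ (k : R) (v : 'rV[R]_r) : extvec (k *: v) = k *: extvec v.
Proof.
by apply/ffunP => S; rewrite !ffunE [RHS]big_distrr; apply: eq_bigr => i _; rewrite mxE.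
Qed.

Lemma extprod_cat (s t : seq 'rV[R]_r) :
  extprod (s ++ t) = extmul (extprod s) (extprod t).
Proof. by elim: s => [|v s IH] /=; rewrite ?extmul1l // IH extmulA. Qed.

Lemma exthom_extprod (s : seq 'rV[R]_r) : exthom (size s) (extprod s).
Proof.
elim: s => [|v s IH] /=; first exact: exthom1.
by rewrite -add1n; apply: exthom_mul => //; exact: exthom_vec.
Qed.

Lemma extprod_shift (v : 'rV[R]_r) s t :
  extprod (s ++ v :: t) = (-1) ^+ size s *: extprod (v :: s ++ t).
Proof.
elim: s => [|w s IH] /=; first by rewrite expr0 scale1r.
rewrite IH /= extmulZr exprS mulN1r scaleNr !extmulA.
by rewrite [extmul (extvec v) (extvec w)]extmul_vecC extmulNl scalerN opprK.
Qed.

(** Sorting a word of indices. The scalar and the set depend on the word only and not on [F], so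
    that over a frame domain they are constant in the base point. *)
Lemma extprod_rows (w : seq 'I_r) : exists (k : R) (S : {set 'I_r}),
  forall F : 'M[R]_r, extprod [seq row i F | i <- w] =
    k *: extprod [seq row i F | i <- enum S].
Proof.
elim: w => [|i w [k [S IH]]].
  by exists 1, set0 => F; rewrite /= scale1r enum_set0.
have [iS|niS] := boolP (i \in S).
  (* A repeated index: the product vanishes, whatever the set. *)
  exists 0, set0 => F; rewrite /= IH scale0r extmulZr.
  have /path.splitPr E : i \in enum S by rewrite mem_enum.
  case: E => s t; rewrite map_cat /= extprod_shift /= extmulZr extmulA.
  by rewrite extmul_vecK extmul0l !scaler0.
have : i \in enum (i |: S) by rewrite mem_enum setU11.
move=> /path.splitPr E; move: (erefl (enum (i |: S))); case: {1}_ / E => s t Est.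
have u : uniq (s ++ i :: t) by rewrite Est enum_uniq.
have ES : enum S = s ++ t.
  have -> : enum S = [seq x <- enum (i |: S) | x != i].
    rewrite /enum_mem -filter_predI; apply: eq_filter => x /=.
    rewrite !inE; case: eqVneq => [->|_] //=; exact: negPf.
  rewrite -Est filter_cat /= eqxx /=; move: u; rewrite cat_uniq /= => /and3P[_].
  rewrite negb_or => /andP[nis _] /andP[nit _].
  by congr (_ ++ _); apply/all_filterP/allP => x xs; apply: contraTneq xs => ->.
(* The new index moves to its place in the increasing enumeration, past the [size s] smaller
   ones. *)
exists (k * (-1) ^+ size s), (i |: S) => F.
by rewrite /= IH ES -Est !map_cat /= extprod_shift extmulZr size_map scalerA -mulrA -expr2 sqrr_sign mulr1.
Qed.

End ExteriorAlgebra.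

(** * Sections of the exterior powers of a vector bundle *)

Section BundleSections.
Context {R : realType} {n : nat} {M : manifold R n} {r : nat}.
Variable (A : vbundle M r).
Implicit Types (f g : M -> R) (P Q : M -> ext R r) (X Y : M -> 'rV[R]_r).

Lemma smooth_fun_bump (U V W : set M) b f :
  open U -> open V -> open W -> Cinf b -> (forall y, W y -> b y = 0) ->
  (U `|` W = setT) -> smooth_fun (U `&` V) f ->
  smooth_fun V (fun y => b y * f y).
Proof.
move=> oU oV oW sb b0 UW sf.
apply: (@smooth_fun_cover _ _ _ bool (fun t => if t then U else W)); first by case.
  move=> x _; have : (U `|` W) x by rewrite UW.
  by case=> ?; [exists true|exists false].
case.
  apply: smooth_funM => //; first exact: openI.
  by apply: smooth_funS sb.
apply: smooth_fun_eq (smooth_fun_cst 0 (openI oW oV)); first exact: openI.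
by move=> y [/b0 -> _]; rewrite mul0r.
Qed.

Lemma smooth_fun_onT (V : set M) f : Cinf f -> smooth_fun V f.
Proof. exact: smooth_funS. Qed.

Lemma Cinf_cst (c : R) : Cinf (fun=> c : R^o) (M := M).
Proof. exact: smooth_fun_cst openT. Qed.

Lemma CinfM f g : Cinf f -> Cinf g -> Cinf (fun x => f x * g x).
Proof. exact: smooth_funM openT. Qed.

Lemma Cinf_exp f k : Cinf f -> Cinf (fun x => f x ^+ k).
Proof.
move=> sf; elim: k => [|k IH]; first by have := Cinf_cst 1.
have -> : (fun x => f x ^+ k.+1) = (fun x => f x * f x ^+ k) by apply/funext => x; rewrite exprS.
exact: CinfM.
Qed.

(** Smoothness may be checked with arbitrary words of frame sections as monomials; [extprod_rows]
    sorts them with constant coefficients. *)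
Lemma GammaExt_span P :
  (forall j : frame_index A, exists (I : finType) (c : I -> M -> R) (w : I -> seq 'I_r),
     (forall i, smooth_fun (frame_dom j) (c i)) /\
     forall x, frame_dom j x ->
       P x = \sum_i c i x *: extprod [seq row k (frame j x) | k <- w i]) ->
  GammaExt A P.
Proof.
move=> H j; have [I [c [w [sc PE]]]] := H j.
have [kS kSE] : exists kS : I -> R * {set 'I_r}, forall i (F : 'M[R]_r),
    extprod [seq row k F | k <- w i] =
    (kS i).1 *: extprod [seq row k F | k <- enum (kS i).2].
  suff H' i : exists kS : R * {set 'I_r}, forall F : 'M[R]_r,
      extprod [seq row k F | k <- w i] = kS.1 *: extprod [seq row k F | k <- enum kS.2].
    by have [kS] := boolp.choice H'; exists kS.
  by have [k [S E]] := @extprod_rows R r (w i); exists (k, S).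
exists (fun S x => \sum_(i | (kS i).2 == S) c i x * (kS i).1); split.
  move=> S; apply: smooth_fun_sum => [|i _]; first exact: frame_dom_open.
  have o := @frame_dom_open _ _ _ _ A j.
  by apply: smooth_funM => //; exact: smooth_fun_cst.
move=> x Dx; rewrite (PE x Dx) (partition_big (fun i => (kS i).2) predT) //=.
apply: eq_bigr => S _; rewrite scaler_suml; apply: eq_bigr => i /eqP ES.
by rewrite kSE ES scalerA.
Qed.

Lemma GammaExt_lin f P Q : Cinf f -> GammaExt A P -> GammaExt A Q ->
  GammaExt A (fun x => f x *: P x + Q x).
Proof.
move=> sf hP hQ j; have [c [sc cE]] := hP j; have [d [sd dE]] := hQ j.
have o := @frame_dom_open _ _ _ _ A j.
exists (fun S x => f x * c S x + d S x); split.
  by move=> S; apply: smooth_funD => //; apply: smooth_funM => //; exact: smooth_fun_onT.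
move=> x Dx; rewrite cE // dE // scaler_sumr -big_split /=.
by apply: eq_bigr => S _; rewrite scalerDl scalerA.
Qed.

Lemma GammaExt0 : GammaExt A (fun=> 0).
Proof.
move=> j; exists (fun _ _ => 0); split=> [S|x _]; first by apply: smooth_fun_cst; exact: frame_dom_open.
by rewrite big1 // => S _; rewrite scale0r.
Qed.

Lemma GammaExt_wedge P Q : GammaExt A P -> GammaExt A Q -> GammaExt A (wedge P Q).
Proof.
move=> hP hQ; apply: GammaExt_span => j.
have [c [sc cE]] := hP j; have [d [sd dE]] := hQ j.
exists ({set 'I_r} * {set 'I_r})%type, (fun ST x => c ST.1 x * d ST.2 x),
  (fun ST : {set 'I_r} * {set 'I_r} => enum ST.1 ++ enum ST.2); split.
  by move=> ST; apply: smooth_funM => //; exact: frame_dom_open.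
move=> x Dx; rewrite /wedge cE // dE // extmul_suml.
rewrite -(pair_bigA _ (fun S T => (c S x * d T x) *: extprod [seq row k (frame j x) | k <- enum S ++ enum T])) /=.
apply: eq_bigr => S _; rewrite extmul_sumr; apply: eq_bigr => T _.
by rewrite extmulZl extmulZr scalerA map_cat extprod_cat.
Qed.

Lemma GammaExt_fun f : Cinf f -> GammaExt A (mvfun r f).
Proof.
move=> sf; apply: GammaExt_span => j.
exists unit, (fun _ => f), (fun _ => [::]); split=> [_|x Dx]; first exact: smooth_fun_onT.
by rewrite big_const card_unit /= addr0.
Qed.

Lemma GammaExt_vec X : Gamma A X -> GammaExt A (mvvec X).
Proof.
move=> sX; apply: GammaExt_span => j.
exists 'I_r, (fun k x => (X x *m invmx (frame j x)) ord0 k), (fun k => [:: k]).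
split=> [k|x Dx]; first exact: sX.
have -> : mvvec X x = extvec (\sum_k (X x *m invmx (frame j x)) ord0 k *: row k (frame j x)).
  by rewrite /mvvec -[X in extvec X](mulmxKV (frame_unit Dx)) [X in extvec X]mulmx_sum_row.
rewrite (big_morph (@extvec R r) (@extvecD R r) (_ : extvec 0 = 0)); last first.
  by rewrite -(scale0r 0) extvecZ scale0r.
by apply: eq_bigr => k _; rewrite extvecZ /= extmul1r.
Qed.

Lemma GammaExtP_lin p f P Q : Cinf f -> GammaExtP A p P -> GammaExtP A p Q ->
  GammaExtP A p (fun x => f x *: P x + Q x).
Proof.
move=> sf [hP pP] [hQ pQ]; split=> [|x S]; first exact: GammaExt_lin.
rewrite !ffunE => nz; have [Q0|/pQ//] := eqVneq (Q x S) 0.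
apply: (pP x); apply: contra_neq nz => P0; by rewrite P0 Q0 addr0 scaler0.
Qed.

Lemma GammaExtP0 p : GammaExtP A p (fun=> 0).
Proof. by split=> [|x S]; [exact: GammaExt0|rewrite ffunE eqxx]. Qed.

Lemma GammaExtP_neg p P : GammaExtP A p P -> p < 0 -> P = fun=> 0.
Proof.
move=> [_ hP] p0; apply/funext => x; apply/ffunP => S; rewrite ffunE.
apply/eqP; apply: contraTT p0 => /hP <-; by rewrite -leNgt.
Qed.

Lemma GammaExtP_exthom p P x : GammaExtP A p P -> exthom `|p|%N (P x).
Proof. by move=> [_ hP] S /hP <-. Qed.

Lemma GammaExtP_wedge p q P Q : GammaExtP A p P -> GammaExtP A q Q ->
  GammaExtP A (p + q) (wedge P Q).
Proof.
move=> hP hQ; have [[gP pP] [gQ pQ]] := (hP, hQ).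
split=> [|x S]; first exact: GammaExt_wedge.
have [p0|p0] := ltP p 0.
  by rewrite /wedge (GammaExtP_neg hP p0) extmul0l ffunE eqxx.
have [q0|q0] := ltP q 0.
  by rewrite /wedge (GammaExtP_neg hQ q0) extmul0r ffunE eqxx.
move=> /(exthom_mul (GammaExtP_exthom (x:=x) hP) (GammaExtP_exthom (x:=x) hQ)) ->.
by rewrite PoszD !gez0_abs.
Qed.

Lemma GammaExtP_fun f : Cinf f -> GammaExtP A 0 (mvfun r f).
Proof.
move=> sf; split=> [|x S]; first exact: GammaExt_fun.
rewrite ffunE => nz; have : ext1 R r S != 0.
  by apply: contra_neq nz => ->; rewrite scaler0.
by move/exthom1 ->.
Qed.

Lemma GammaExtP_vec X : Gamma A X -> GammaExtP A 1 (mvvec X).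
Proof.
move=> sX; split=> [|x S]; first exact: GammaExt_vec.
by move/exthom_vec ->.
Qed.

Lemma wedges_cat (s t : seq (M -> 'rV[R]_r)) :
  wedges (s ++ t) = wedge (wedges s) (wedges t).
Proof.
apply/funext => x; elim: s => [|X s IH] /=.
  by rewrite /wedge /mvfun scale1r extmul1l.
by rewrite /wedge /= -/(wedges _) IH /wedge extmulA.
Qed.

Lemma GammaExtP_wedges s : Gamma_seq A s -> GammaExtP A (size s)%:Z (wedges s).
Proof.
elim: s => [|X s IH] sG; first by have := GammaExtP_fun (Cinf_cst 1).
rewrite /= -[X in GammaExtP _ X _]/((1 + size s)%N%:Z) PoszD.
apply: GammaExtP_wedge; first by apply: GammaExtP_vec; exact: (sG 0%N).
by apply: IH => i Hi; exact: (sG i.+1).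
Qed.

Lemma wedges_extprod s x : wedges s x = extprod [seq X x | X : M -> 'rV[R]_r <- s].
Proof. by elim: s => [|X s IH] /=; rewrite /mvfun ?scale1r // /wedge -IH. Qed.

(** Monomials in the rows of the frame are homogeneous, so comparing coefficients discards the terms
    whose size is not [p]. *)
Lemma GammaExtP_frame p P (j : frame_index A) : GammaExtP A p P ->
  exists c : {set 'I_r} -> M -> R, (forall S, smooth_fun (frame_dom j) (c S)) /\
    forall x, frame_dom j x -> P x = \sum_(S : {set 'I_r} | #|S|%:Z == p)
      c S x *: extprod [seq row i (frame j x) | i <- enum S].
Proof.
move=> [gP hP]; have [c [sc cE]] := gP j; exists c; split=> // x Dx.
apply/ffunP => T; rewrite sum_ffunE; have := cE x Dx => /ffunP/(_ T); rewrite sum_ffunE => E.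
have hE (S : {set 'I_r}) : exthom #|S| (extprod [seq row i (frame j x) | i <- enum S]).
  by have := @exthom_extprod R r [seq row i (frame j x) | i <- enum S]; rewrite size_map -cardE.
have [PT|nPT] := eqVneq (P x T) 0; last first.
  have pE := hP x T nPT; rewrite E (bigID (fun S : {set 'I_r} => #|S|%:Z == p)) /= [X in _ + X]big1 ?addr0 // => S nS.
  rewrite ffunE; have [->|/hE ES] := eqVneq (extprod [seq row i (frame j x) | i <- enum S] T) 0; first by rewrite scaler0.
  by move: nS; rewrite -pE ES eqxx.
have [Tp|nTp] := eqVneq (#|T|%:Z) p.
  rewrite E (bigID (fun S : {set 'I_r} => #|S|%:Z == p)) /= [X in _ + X]big1 ?addr0 // => S nS.
  rewrite ffunE; have [->|/hE ES] := eqVneq (extprod [seq row i (frame j x) | i <- enum S] T) 0; first by rewrite scaler0.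
  by move: nS; rewrite -Tp ES eqxx.
rewrite PT big1 // => S /eqP ES; rewrite ffunE.
have [->|/hE ET] := eqVneq (extprod [seq row i (frame j x) | i <- enum S] T) 0; first by rewrite scaler0.
by move: nTp; rewrite ET ES eqxx.
Qed.

Lemma Gamma_bump (j : frame_index A) (i : 'I_r) b (W : set M) :
  open W -> Cinf b -> (forall y, W y -> b y = 0) ->
  (frame_dom j `|` W = setT) -> Gamma A (fun x => b x *: row i (frame j x)).
Proof.
move=> oW sb b0 UW j' k.
have o := @frame_dom_open _ _ _ _ A j; have o' := @frame_dom_open _ _ _ _ A j'.
have := smooth_fun_bump o o' oW sb b0 UW (@frame_transition _ _ _ _ A j j' i k).
apply: smooth_fun_eq => // x _; by rewrite -scalemxAl [in RHS]mxE -row_mul [in RHS]mxE.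
Qed.

(* A smooth bump function [b] supported in a frame domain makes [b^(r+1) P] a
   global combination of products of sections. *)
Lemma Cinf_linear_eq0 p (Phi : (M -> ext R r) -> (M -> ext R r)) :
  (forall f P Q, Cinf f -> GammaExtP A p P -> GammaExtP A p Q ->
     Phi (fun x => f x *: P x + Q x) = (fun x => f x *: Phi P x + Phi Q x)) ->
  (forall s, Gamma_seq A s -> (size s)%:Z = p -> Phi (wedges s) = (fun=> 0)) ->
  forall P, GammaExtP A p P -> Phi P = (fun=> 0).
Proof.
move=> PhiL Phi0 P hP; apply/funext => x.
have [j Dx] := frame_cover A x; have oj := @frame_dom_open _ _ _ _ A j.
have [b [W [sb bx oW b0 UW]]] := bump_function oj Dx.
have [c [sc cE]] := GammaExtP_frame j hP.
have PhiZ : Phi (fun=> 0) = fun=> 0.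
  have := PhiL (fun=> 1) _ _ (Cinf_cst 1) (GammaExtP0 p) (GammaExtP0 p).
  rewrite (_ : (fun _ => _) = (fun=> 0)); last by apply/funext => y; rewrite scaler0 addr0.
  move=> E; apply/funext => y; move/(congr1 (fun F => F y)): E => /=.
  by rewrite scale1r => /eqP; rewrite -subr_eq0 opprD addrA subrr sub0r oppr_eq0 => /eqP.
pose Y i y := b y *: row i (frame j y).
have sY i : Gamma A (Y i) by exact: Gamma_bump oW sb b0 UW.
(* The sections [Y i] for [i] in [S] carry [b ^+ #|S|], and one more [b] makes the local coefficient
   [c S] globally smooth. The last factor brings the total power to [r.+1] for every [S]. *)
pose f S y := b y * c S y * b y ^+ (r - #|S|).
have sf S : Cinf (f S).
  apply: CinfM; last exact: Cinf_exp.
  by apply: smooth_fun_bump oj openT oW sb b0 UW _; rewrite setIT; exact: sc.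
have gS (S : {set 'I_r}) : Gamma_seq A [seq Y i | i <- enum S].
  move=> k; rewrite size_map => kS; case E: (enum S) kS => [//|i0 l] kS.
  by rewrite (nth_map i0).
have hw (S : {set 'I_r}) : #|S|%:Z = p -> GammaExtP A p (wedges [seq Y i | i <- enum S]).
  by move=> <-; have := GammaExtP_wedges (gS S); rewrite size_map -cardE.
have PhiS (l : seq {set 'I_r}) : GammaExtP A p (fun y => \sum_(S <- l | #|S|%:Z == p) f S y *: wedges [seq Y i | i <- enum S] y) /\
   Phi (fun y => \sum_(S <- l | #|S|%:Z == p) f S y *: wedges [seq Y i | i <- enum S] y) = fun=> 0.
  elim: l => [|S l [IH1 IH2]].
    have -> : (fun y => \sum_(S <- [::] : seq {set 'I_r} | #|S|%:Z == p) f S y *: wedges [seq Y i | i <- enum S] y) = fun=> 0.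
      by apply/funext => y; rewrite big_nil.
    by split=> //; exact: GammaExtP0.
  have [/eqP Sp|nSp] := boolP (#|S|%:Z == p); last first.
    under eq_fun do rewrite big_cons (negPf nSp).
    by [].
  under eq_fun do rewrite big_cons Sp eqxx.
  split; first by apply: GammaExtP_lin => //; exact: hw.
  rewrite PhiL //; last exact: hw.
  rewrite IH2 Phi0 //; last by rewrite size_map -cardE.
  by apply/funext => y; rewrite scaler0 addr0.
(* As [b x = 1], the value at [x] is unchanged when [P] is multiplied by a power of [b]. *)
have := PhiL (fun y => b y ^+ r.+1) _ _ (Cinf_exp r.+1 sb) hP (GammaExtP0 p).
rewrite PhiZ => /(congr1 (fun F => F x)) /=; rewrite bx expr1n scale1r addr0 => <-.
rewrite (_ : (fun y => _) = fun y => \sum_(S : {set 'I_r} | #|S|%:Z == p) f S y *: wedges [seq Y i | i <- enum S] y).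
  by rewrite (PhiS _).2.
apply/funext => y; rewrite addr0.
have : (frame_dom j `|` W) y by rewrite UW.
case=> [Dy|Wy]; last first.
  (* Off the frame domain [b] vanishes: the exponent [r.+1] is positive and each [f S] has a factor
     [b]. *)
  by rewrite (b0 _ Wy) expr0n /= scale0r big1 // => S _; rewrite /f (b0 _ Wy) !mul0r scale0r.
rewrite cE // scaler_sumr; apply: eq_bigr => S _.
rewrite wedges_extprod -map_comp scalerA.
have extZ (l : seq 'I_r) : extprod [seq ((fun X => X y) \o Y) i | i <- l] =
   b y ^+ size l *: extprod [seq row i (frame j y) | i <- l].
  elim: l => [|i l IH] /=; first by rewrite expr0 scale1r.
  by rewrite IH /Y extvecZ extmulZl extmulZr scalerA -exprS.
rewrite extZ scalerA -cardE /f; congr (_ *: _).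
have Sr : (#|S| <= r)%N by have := max_card S; rewrite card_ord.
by rewrite -[r in LHS](subnK Sr) exprS exprD; ring.
Qed.

Lemma Gamma_tapp N X : tensor11 A N -> Gamma A X -> Gamma A (tapp N X).
Proof.
move=> sN sX j k; have o := @frame_dom_open _ _ _ _ A j.
have := smooth_fun_sum (enum 'I_r) (P := predT) o (fun i _ => smooth_funM o (sX j i) (sN j i k)).
apply: smooth_fun_eq => // x Dx.
have -> : tapp N X x *m invmx (frame j x) =
   (X x *m invmx (frame j x)) *m (frame j x *m N x *m invmx (frame j x)).
  by rewrite /tapp !mulmxA mulmxKV ?frame_unit.
by rewrite mxE big_enum.
Qed.

Lemma Cinf_mvfun f : GammaExtP A 0 (mvfun r f) -> Cinf f.
Proof.
move=> hf; apply: (@smooth_fun_cover _ _ _ (frame_index A) (@frame_dom _ _ _ _ A)).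
- exact: frame_dom_open.
- by move=> x _; exact: frame_cover.
move=> j; rewrite setIT; have [c [sc cE]] := GammaExtP_frame j hf.
apply: smooth_fun_eq (sc finset.set0); first exact: frame_dom_open.
move=> x Dx; have /ffunP/(_ finset.set0) := cE x Dx.
rewrite (big_pred1 finset.set0); last by move=> S /=; rewrite -finset.cards_eq0 eqz_nat.
by rewrite enum_set0 /= !ffunE eqxx /GRing.scale /= !mulr1.
Qed.

End BundleSections.

(** * Graded derivations and biderivations *)

Section Parity.
Context {R : realType}.
Implicit Types (m k : int).

Definition oddz m : bool := odd `|m|%N.

Lemma oddzD m k : oddz (m + k) = oddz m (+) oddz k.
Proof. by rewrite /oddz; lia. Qed.

Lemma oddzM m k : oddz (m * k) = oddz m && oddz k.
Proof. by rewrite /oddz abszM oddM. Qed.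

Lemma oddzN m : oddz (- m) = oddz m.
Proof. by rewrite /oddz abszN. Qed.

(** Turns every Koszul sign into a boolean: sign identities become case splits on the parities of
    the degrees, closed by [ring]. *)
Lemma signz m : (-1 : R) ^ m = if oddz m then -1 else 1.
Proof. by rewrite expN1r -signr_odd /oddz; case: odd. Qed.

End Parity.

Section GradedDerivations.
Context {R : realType} {n : nat} {M : manifold R n} {r : nat}.
Variable (A : vbundle M r).
Local Notation E := (M -> ext R r).
Local Notation H := (GammaExt2 A).
Implicit Types (P Q S : E) (x y z : int * E) (d e : int) (D : int * E -> E)
  (B : int * E -> int * E -> E).

Lemma sectionDE P Q m (S : {set 'I_r}) : (P + Q) m S = P m S + Q m S.
Proof. by rewrite fctE ffunE. Qed.

Lemma sectionNE P m (S : {set 'I_r}) : (- P) m S = - P m S.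
Proof. by rewrite fctE ffunE. Qed.

Lemma sectionZE (a : R) P m (S : {set 'I_r}) : (a *: P) m S = a * P m S.
Proof. by rewrite fctE ffunE. Qed.

Lemma section0E m (S : {set 'I_r}) : (0 : E) m S = 0.
Proof. by rewrite [LHS]ffunE. Qed.

Lemma wedgeDl P P' Q : wedge (P + P') Q = wedge P Q + wedge P' Q.
Proof. by apply/funext => m; rewrite /wedge extmulDl. Qed.

Lemma wedgeDr P Q Q' : wedge P (Q + Q') = wedge P Q + wedge P Q'.
Proof. by apply/funext => m; rewrite /wedge extmulDr. Qed.

Lemma wedgeZl (a : R) P Q : wedge (a *: P) Q = a *: wedge P Q.
Proof. by apply/funext => m; rewrite /wedge extmulZl. Qed.

Lemma wedgeZr (a : R) P Q : wedge P (a *: Q) = a *: wedge P Q.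
Proof. by apply/funext => m; rewrite /wedge extmulZr. Qed.

Lemma wedgeNl P Q : wedge (- P) Q = - wedge P Q.
Proof. by rewrite -scaleN1r wedgeZl scaleN1r. Qed.

Lemma wedgeNr P Q : wedge P (- Q) = - wedge P Q.
Proof. by rewrite -scaleN1r wedgeZr scaleN1r. Qed.

Lemma wedge0l Q : wedge 0 Q = 0.
Proof. by apply/funext => m; rewrite /wedge extmul0l. Qed.

Lemma wedge0r Q : wedge Q 0 = 0.
Proof. by apply/funext => m; rewrite /wedge extmul0r. Qed.

Lemma wedgeA P Q S : wedge P (wedge Q S) = wedge (wedge P Q) S.
Proof. by apply/funext => m; rewrite /wedge extmulA. Qed.

Lemma wedge_fun f P : wedge (mvfun r f) P = fun m => f m *: P m.
Proof. by apply/funext => m; rewrite /wedge /mvfun extmulZl extmul1l. Qed.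

Lemma homD e P Q : H e P -> H e Q -> H e (P + Q).
Proof.
move=> hP hQ; have := GammaExtP_lin (Cinf_cst 1) hP hQ.
by congr GammaExtP; apply/funext => m; rewrite scale1r.
Qed.

Lemma hom0 e : H e 0.
Proof. exact: GammaExtP0. Qed.

Lemma homZ e (a : R) P : H e P -> H e (a *: P).
Proof.
move=> hP; have := GammaExtP_lin (Cinf_cst a) hP (GammaExtP0 A _).
by congr GammaExtP; apply/funext => m; rewrite addr0.
Qed.

Lemma homN e P : H e P -> H e (- P).
Proof. by rewrite -scaleN1r; exact: homZ. Qed.

Lemma hom_wedge d e P Q : H d P -> H e Q -> H (d + e + 2) (wedge P Q).
Proof.
move=> hP hQ; have := GammaExtP_wedge hP hQ.
by rewrite /GammaExt2; congr GammaExtP; ring.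
Qed.

Lemma hom_neg e P : H e P -> e + 2 < 0 -> P = 0.
Proof. exact: GammaExtP_neg. Qed.

(* The degrees are those of Gamma(/\A)[2]: a p-vector has degree e = p - 2, hence
   the shift by 2 in the degree of a wedge product. *)
Definition deriv d D : Prop :=
  [/\ forall e P, H e P -> H (e + d) (D (e, P)),
      forall e (a : R) P Q, H e P -> H e Q -> D (e, a *: P + Q) = a *: D (e, P) + D (e, Q) &
      forall e f P Q, H e P -> H f Q -> D (e + f + 2, wedge P Q) =
        wedge (D (e, P)) Q + (-1 : R) ^ (d * e) *: wedge P (D (f, Q))].

Lemma deriv0 d D e : deriv d D -> D (e, 0) = 0.
Proof.
move=> [_ DL _]; have := DL e 1 0 0 (hom0 e) (hom0 e).
by rewrite !scale1r addr0 => /eqP; rewrite -subr_eq0 opprD addrA subrr sub0r oppr_eq0 => /eqP.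
Qed.

Lemma derivZ d D e (a : R) P : deriv d D -> H e P -> D (e, a *: P) = a *: D (e, P).
Proof.
move=> dD hP; have [_ DL _] := dD.
by have := DL e a P 0 hP (hom0 e); rewrite !addr0 (deriv0 _ dD) addr0.
Qed.

Lemma derivD d D e P Q : deriv d D -> H e P -> H e Q ->
  D (e, P + Q) = D (e, P) + D (e, Q).
Proof. by move=> [_ DL _] hP hQ; have := DL e 1 P Q hP hQ; rewrite !scale1r. Qed.

Lemma deriv_ext d D D' : (forall x, H x.1 x.2 -> D x = D' x) ->
  deriv d D -> deriv d D'.
Proof.
move=> DD [Dh DL DM]; split.
- by move=> e P hP; rewrite -DD //; exact: Dh.
- by move=> e a P Q hP hQ; rewrite -!DD //=; [exact: DL|apply: homD => //; exact: homZ].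
- move=> e f P Q hP hQ; rewrite -!DD //=; [exact: DM|exact: hom_wedge].
Qed.

Lemma deriv_lin d D D' (a : R) : deriv d D -> deriv d D' ->
  deriv d (fun x => a *: D x + D' x).
Proof.
move=> [Dh DL DM] [Dh' DL' DM']; split.
- by move=> e P hP; apply: homD; [apply: homZ; exact: Dh|exact: Dh'].
- move=> e b P Q hP hQ; rewrite DL // DL' //.
  by apply/funext => m; apply/ffunP => S; rewrite !(sectionDE, sectionZE); ring.
- move=> e f P Q hP hQ; rewrite DM // DM' // wedgeDl wedgeDr wedgeZl wedgeZr.
  by apply/funext => m; apply/ffunP => S; rewrite !(sectionDE, sectionZE); ring.
Qed.

Lemma deriv_cst0 d : deriv d (fun=> 0).
Proof.
by split=> *; rewrite ?scaler0 ?wedge0l ?wedge0r ?scaler0 ?addr0 //; exact: hom0.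
Qed.

(* The graded commutator of two derivations is a derivation. *)
Lemma deriv_comm d d' D D' : deriv d D -> deriv d' D' ->
  deriv (d + d') (fun x => D (x.1 + d', D' x) -
                           (-1 : R) ^ (d * d') *: D' (x.1 + d, D x)).
Proof.
move=> dD dD'; have [Dh DL DM] := dD; have [Dh' DL' DM'] := dD'; split => /=.
- move=> e P hP; apply: homD; last apply: homN; last apply: homZ.
    by have := Dh _ _ (Dh' _ _ hP); rewrite -addrA [d' + d]addrC.
  by have := Dh' _ _ (Dh _ _ hP); rewrite -addrA.
- move=> e a P Q hP hQ; have [h1 h2 h3 h4] := And4 (Dh _ _ hP) (Dh _ _ hQ) (Dh' _ _ hP) (Dh' _ _ hQ).
  rewrite DL // DL' // DL // DL' //.
  by apply/funext => m; apply/ffunP => S; rewrite !(sectionDE, sectionZE, sectionNE); ring.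
- move=> e f P Q hP hQ; have [h1 h2 h3 h4] := And4 (Dh _ _ hP) (Dh _ _ hQ) (Dh' _ _ hP) (Dh' _ _ hQ).
  rewrite DM // DM' //.
  have E1 k : e + f + 2 + k = e + k + f + 2 by ring.
  have E2 k : e + f + 2 + k = e + (f + k) + 2 by ring.
  have w1 k P1 Q1 : H (e + k) P1 -> H f Q1 -> H (e + f + 2 + k) (wedge P1 Q1).
    by move=> ? ?; rewrite E1; exact: hom_wedge.
  have w2 k P1 Q1 : H e P1 -> H (f + k) Q1 -> H (e + f + 2 + k) (wedge P1 Q1).
    by move=> ? ?; rewrite E2; exact: hom_wedge.
  rewrite (derivD dD); [|exact: w1|apply: homZ; exact: w2].
  rewrite (derivD dD'); [|exact: w1|apply: homZ; exact: w2].
  rewrite (derivZ _ dD); last exact: w2.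
  rewrite (derivZ _ dD'); last exact: w2.
  rewrite {1}E1 DM // {1}E2 DM // {1}E1 DM' // {1}E2 DM' //.
  rewrite !(wedgeDl, wedgeDr, wedgeNl, wedgeNr, wedgeZl, wedgeZr).
  apply/funext => m; apply/ffunP => S; rewrite !(sectionDE, sectionZE, sectionNE).
  rewrite !signz !(oddzD, oddzM).
  by case: (oddz d); case: (oddz d'); case: (oddz e); rewrite /=; ring.
Qed.

Definition generator x : Prop :=
  (exists2 f, Cinf f & x = (-2, mvfun r f)) \/
  (exists2 X, Gamma A X & x = (-1, mvvec X)).

Lemma generator_hom x : generator x -> H x.1 x.2.
Proof. by case=> [[f sf ->]|[X sX ->]]; [exact: GammaExtP_fun|exact: GammaExtP_vec]. Qed.

(** By the Leibniz rule $D(fP) = Df \wedge P + f\,DP$, a derivation that kills the functions is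
    linear over them, and [Cinf_linear_eq0] applies; products of sections are handled by induction
    on the number of factors. *)
Lemma deriv_eq0 d D : deriv d D -> (forall x, generator x -> D x = 0) ->
  forall x, H x.1 x.2 -> D x = 0.
Proof.
move=> dD D0 [e P] hP; have [Dh DL DM] := dD.
have Df f : Cinf f -> D (-2, mvfun r f) = 0 by move=> sf; apply: D0; left; exists f.
have DX X : Gamma A X -> D (-1, mvvec X) = 0 by move=> sX; apply: D0; right; exists X.
apply: (Cinf_linear_eq0 (p := e + 2) (Phi := fun P => D (e, P))) hP => /=.
- move=> f P' Q sf hP hQ.
  have -> : (fun m => f m *: P' m + Q m) = wedge (mvfun r f) P' + Q by rewrite wedge_fun.
  have Ee : e = -2 + e + 2 by ring.
  have hf : H (-2) (mvfun r f) by exact: GammaExtP_fun.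
  have hfP : H e (wedge (mvfun r f) P') by rewrite {1}Ee; exact: hom_wedge.
  rewrite (derivD dD) // {1}Ee DM // Df // wedge0l add0r wedge_fun.
  have -> : (-1 : R) ^ (d * -2) = 1 by rewrite signz oddzM andbF.
  by rewrite scale1r.
- move=> s sG sz; have -> : e = (size s)%:Z - 2 by rewrite sz addrK.
  elim: s sG {sz} => [|X s IH] sG; first exact: Df (Cinf_cst 1).
  have sG' : Gamma_seq A s by move=> i; exact: (sG i.+1).
  have hX := sG 0%N isT.
  have -> : (size (X :: s))%:Z - 2 = -1 + ((size s)%:Z - 2) + 2 by rewrite /= -addn1 PoszD; ring.
  rewrite /= -/(wedges s) DM; last first.
  + by have := GammaExtP_wedges sG'; rewrite /GammaExt2 subrK.
  + exact: GammaExtP_vec.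
  by rewrite DX // IH // wedge0l wedge0r scaler0 addr0.
Qed.

(** * Biderivations, triderivations and their brackets *)

Definition biderivation d B : Prop :=
  (forall x, H x.1 x.2 -> deriv (x.1 + d) (B x)) /\
  (forall x y, H x.1 x.2 -> H y.1 y.2 ->
     B x y = (-1 : R) ^ (x.1 * y.1) *: B y x).

Section Biderivations.
Variables (d : int) (B : int * E -> int * E -> E).
Hypothesis bB : biderivation d B.

Lemma bideriv_hom x y : H x.1 x.2 -> H y.1 y.2 -> H (x.1 + y.1 + d) (B x y).
Proof.
move=> hx; case: y => e P hP; have [Dh _ _] := bB.1 x hx.
by have := Dh e P hP; congr (H _ _) => /=; ring.
Qed.

Lemma bideriv_linl e (a : R) P Q y : H e P -> H e Q -> H y.1 y.2 ->
  B (e, a *: P + Q) y = a *: B (e, P) y + B (e, Q) y.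
Proof.
move=> hP hQ hy; have hPQ : H e (a *: P + Q) by apply: homD => //; exact: homZ.
rewrite !(bB.2 _ y) //; case: y hy => f S hS; have [_ DL _] := bB.1 (f, S) hS.
by rewrite DL //= scalerDr !scalerA mulrC.
Qed.

Lemma bideriv0l e y : H y.1 y.2 -> B (e, 0) y = 0.
Proof.
move=> hy; rewrite (bB.2 (e, 0) y (hom0 e) hy) (deriv0 _ (bB.1 y hy)).
by rewrite scaler0.
Qed.

Lemma biderivZl e (a : R) P y : H e P -> H y.1 y.2 ->
  B (e, a *: P) y = a *: B (e, P) y.
Proof.
by move=> hP hy; have := bideriv_linl a hP (hom0 e) hy; rewrite !addr0 bideriv0l // addr0.
Qed.

(** Two passes: [deriv_eq0] frees the second argument while the first is a generator; symmetry
    exchanges the arguments, and [deriv_eq0] applies again. *)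
Lemma bideriv_eq0 : (forall x y, generator x -> generator y -> B x y = 0) ->
  forall x y, H x.1 x.2 -> H y.1 y.2 -> B x y = 0.
Proof.
move=> B0; have Bg x y : generator x -> H y.1 y.2 -> B x y = 0.
  by move=> gx; apply: deriv_eq0 (bB.1 x (generator_hom gx)) _ y => y; exact: B0.
move=> x y hx; apply: deriv_eq0 (bB.1 x hx) _ y => y gy.
by rewrite (bB.2 x y hx (generator_hom gy)) Bg // scaler0.
Qed.

End Biderivations.

Definition triderivation d (T : int * E -> int * E -> int * E -> E) : Prop :=
  [/\ forall x y, H x.1 x.2 -> H y.1 y.2 -> deriv (x.1 + y.1 + d) (T x y),
      forall x y z, H x.1 x.2 -> H y.1 y.2 -> H z.1 z.2 ->
        T x y z = (-1 : R) ^ (x.1 * y.1) *: T y x z &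
      forall x y z, H x.1 x.2 -> H y.1 y.2 -> H z.1 z.2 ->
        T x y z = (-1 : R) ^ (y.1 * z.1) *: T x z y].

Lemma trideriv_eq0 d T : triderivation d T ->
  (forall x y z, generator x -> generator y -> generator z -> T x y z = 0) ->
  forall x y z, H x.1 x.2 -> H y.1 y.2 -> H z.1 z.2 -> T x y z = 0.
Proof.
move=> [TD T12 T23] T0; have gh := generator_hom.
have T1 x y z : generator x -> generator y -> H z.1 z.2 -> T x y z = 0.
  by move=> gx gy; apply: deriv_eq0 (TD x y (gh _ gx) (gh _ gy)) _ z => z; exact: T0.
have T2 x y z : generator x -> H y.1 y.2 -> H z.1 z.2 -> T x y z = 0.
  move=> gx hy; apply: deriv_eq0 (TD x y (gh _ gx) hy) _ z => z gz.
  by rewrite T23 ?T1 ?scaler0 //; exact: gh.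
move=> x y z hx hy; apply: deriv_eq0 (TD x y hx hy) _ z => z gz; have hz := gh _ gz.
by rewrite T23 // T12 // T2 // !scaler0.
Qed.

(* The Richardson-Nijenhuis brackets of forms D, B of arities 1 and 2 and degrees
   dD and d, and of forms B, B' of arity 2 and degrees d and d' *)
Definition bracket12 dD d D B x y : E :=
  B (x.1 + dD, D x) y + (-1 : R) ^ (x.1 * y.1) *: B (y.1 + dD, D y) x
  - D (x.1 + y.1 + d, B x y).

(** For fixed [x], the bracket is the derivation [B (D x)] plus the graded commutator of [B x] and
    [D]. *)
Lemma bracket12_biderivation d D B :
  deriv 0 D -> biderivation d B -> biderivation d (bracket12 0 d D B).
Proof.
move=> dD bB; have [Dh _ _] := dD.
have Dh' x : H x.1 x.2 -> H (x.1 + 0) (D x) by case: x => e P; exact: Dh.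
split=> [x hx|x y hx hy].
  have d1 := bB.1 (x.1 + 0, D x) (Dh' x hx); rewrite /= addr0 in d1.
  have d2 := deriv_comm (bB.1 x hx) dD; rewrite addr0 in d2.
  apply: deriv_ext (deriv_lin 1 d1 d2) => y hy.
  rewrite /bracket12 (bB.2 (y.1 + 0, D y) x) //=; last exact: Dh'.
  rewrite scale1r mulr0 !addr0 expr0z scale1r scalerA addrA.
  have -> : y.1 + (x.1 + d) = x.1 + y.1 + d by ring.
  by rewrite [y.1 * _]mulrC -expfzDr ?oppr_eq0 ?oner_eq0 // signz oddzD addbb scale1r.
have hB := bideriv_hom bB hx hy.
rewrite /bracket12 (bB.2 y x) //.
have -> : y.1 + x.1 + d = x.1 + y.1 + d by ring.
rewrite (derivZ _ dD hB).
apply/funext => m; apply/ffunP => S; rewrite !(sectionDE, sectionZE, sectionNE).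
rewrite !signz !(oddzD, oddzM).
by case: (oddz x.1); case: (oddz y.1); rewrite /=; ring.
Qed.

(** The three terms are the unshuffles of type (2,1) with their Koszul signs. *)
Definition insert22 d B B' x y z : E :=
  B' (x.1 + y.1 + d, B x y) z
  + (-1 : R) ^ (y.1 * z.1) *: B' (x.1 + z.1 + d, B x z) y
  + (-1 : R) ^ (x.1 * (y.1 + z.1)) *: B' (y.1 + z.1 + d, B y z) x.

Definition bracket22 d d' B B' x y z : E :=
  insert22 d B B' x y z - insert22 d' B' B x y z.

Lemma insert22_sym12 d d' B B' x y z :
  biderivation d B -> biderivation d' B' ->
  H x.1 x.2 -> H y.1 y.2 -> H z.1 z.2 ->
  insert22 d B B' x y z = (-1 : R) ^ (x.1 * y.1) *: insert22 d B B' y x z.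
Proof.
move=> bB bB' hx hy hz; rewrite /insert22 (bB.2 y x) //.
have hxy : H (y.1 + x.1 + d) (B x y) by rewrite [y.1 + _]addrC; exact: bideriv_hom.
rewrite (biderivZl bB') // [y.1 + x.1]addrC.
apply/funext => m; apply/ffunP => S; rewrite !(sectionDE, sectionZE, sectionNE).
rewrite !signz !(oddzD, oddzM).
by case: (oddz x.1); case: (oddz y.1); case: (oddz z.1); rewrite /=; ring.
Qed.

Lemma insert22_sym23 d d' B B' x y z :
  biderivation d B -> biderivation d' B' ->
  H x.1 x.2 -> H y.1 y.2 -> H z.1 z.2 ->
  insert22 d B B' x y z = (-1 : R) ^ (y.1 * z.1) *: insert22 d B B' x z y.
Proof.
move=> bB bB' hx hy hz; rewrite /insert22 (bB.2 z y) //.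
have hyz : H (z.1 + y.1 + d) (B y z) by rewrite [z.1 + _]addrC; exact: bideriv_hom.
rewrite (biderivZl bB') // [z.1 + y.1]addrC.
apply/funext => m; apply/ffunP => S; rewrite !(sectionDE, sectionZE, sectionNE).
rewrite !signz !(oddzD, oddzM).
by case: (oddz x.1); case: (oddz y.1); case: (oddz z.1); rewrite /=; ring.
Qed.

(** For fixed [x] and [y], the bracket is a combination of the derivations [B' (B x y)] and
    [B (B' x y)] and of the graded commutators of [B' y] with [B x] and of [B' x] with [B y]. As
    [d = 0], the sign $(-1)^{d d'}$ of the bracket is 1, in agreement with [bracket22]. *)
Lemma bracket22_triderivation d d' B B' : d = 0 ->
  biderivation d B -> biderivation d' B' ->
  triderivation (d + d') (bracket22 d d' B B').
Proof.
move=> d0 bB bB'; split; last 2 first.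
- move=> x y z hx hy hz; rewrite /bracket22.
  by rewrite (insert22_sym12 bB bB') // (insert22_sym12 bB' bB) // scalerBr.
- move=> x y z hx hy hz; rewrite /bracket22.
  by rewrite (insert22_sym23 bB bB') // (insert22_sym23 bB' bB) // scalerBr.
move=> x y hx hy.
have d1 := bB'.1 (x.1 + y.1 + d, B x y) (bideriv_hom bB hx hy).
have d2 := bB.1 (x.1 + y.1 + d', B' x y) (bideriv_hom bB' hx hy).
have d3 := deriv_comm (bB'.1 y hy) (bB.1 x hx).
have d4 := deriv_comm (bB'.1 x hx) (bB.1 y hy).
have e1 : x.1 + y.1 + d + d' = x.1 + y.1 + (d + d') by ring.
have e2 : x.1 + y.1 + d' + d = x.1 + y.1 + (d + d') by ring.
have e3 : y.1 + d' + (x.1 + d) = x.1 + y.1 + (d + d') by ring.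
have e4 : x.1 + d' + (y.1 + d) = x.1 + y.1 + (d + d') by ring.
rewrite /= ?e1 ?e2 ?e3 ?e4 in d1 d2 d3 d4.
have d0' := deriv_cst0 (x.1 + y.1 + (d + d')).
(* The coefficients of [d3] and [d4] are the signs left once symmetry has brought [B x z] and
   [B y z] to the second argument of [B']. *)
apply: deriv_ext (deriv_lin (-1) d2 (deriv_lin 1 d1
  (deriv_lin ((-1) ^ ((x.1 + d) * y.1)) d3 (deriv_lin ((-1) ^ (x.1 * d)) d4 d0')))) => z hz.
rewrite /bracket22 /insert22.
rewrite (bB'.2 (x.1 + z.1 + d, B x z) y) //; last exact: bideriv_hom.
rewrite (bB'.2 (y.1 + z.1 + d, B y z) x) //; last exact: bideriv_hom.
rewrite (bB.2 (x.1 + z.1 + d', B' x z) y) //; last exact: bideriv_hom.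
rewrite (bB.2 (y.1 + z.1 + d', B' y z) x) //=; last exact: bideriv_hom.
have c1 (u v w : int) : w + (u + v) = u + w + v by ring.
rewrite !c1.
apply/funext => m; apply/ffunP => S; rewrite !(sectionDE, sectionZE, sectionNE, section0E).
rewrite !signz !(oddzD, oddzM) d0.
case: (oddz x.1); case: (oddz y.1); case: (oddz z.1); case: (oddz d'); rewrite /=; ring.
Qed.

End GradedDerivations.

(** * The insertion operator on forms with components of arity 1 and 2 *)

Section UnshuffleSums.
Lemma sum_perm1 (V : nmodType) (F : 'S_1 -> V) : \sum_sigma F sigma = F 1%g.
Proof.
rewrite (bigD1 1%g) //= big1 ?addr0 // => sigma /eqP []; apply/permP => i.
by rewrite !ord1.
Qed.

(** A duplicate-free list of the right length enumerates the group, so that sums over permutations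
    can be written out. *)
Lemma sum_perm_seq n (V : nmodType) (l : seq 'S_n) (F : 'S_n -> V) :
  uniq l -> size l = n`! -> \sum_sigma F sigma = \sum_(sigma <- l) F sigma.
Proof.
move=> ul sl; apply: perm_big; apply: uniq_perm => //; first exact: index_enum_uniq.
have : (size (index_enum 'S_n) <= size l)%N.
  by rewrite sl -card_Sn cardE enumT -[X in (_ <= X)%N]/(size _) /index_enum unlock.
move=> sz; have sub : {subset l <= index_enum 'S_n} by move=> x _; exact: mem_index_enum.
have [_ h] := uniq_min_size ul sub sz.
by move=> x; rewrite -h.
Qed.

Definition perms2 : seq 'S_2 := [:: 1%g; tperm ord0 ord_max].

Lemma perms2_uniq : uniq perms2.
Proof.
rewrite /= inE andbT; apply/negP => /eqP /permP /(_ ord0).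
by rewrite perm1 tpermL.
Qed.

Let o0 : 'I_3 := Ordinal (isT : 0 < 3)%N.
Let o1 : 'I_3 := Ordinal (isT : 1 < 3)%N.
Let o2 : 'I_3 := Ordinal (isT : 2 < 3)%N.

Definition perms3 : seq 'S_3 :=
  [:: 1%g; tperm o0 o1; (tperm o1 o2 * tperm o0 o1)%g; tperm o1 o2;
      (tperm o0 o1 * tperm o1 o2)%g; tperm o0 o2].

Lemma perms3_uniq : uniq perms3.
Proof.
apply: (@map_uniq _ _ (fun sigma : 'S_3 => (val (sigma o0), val (sigma o1)))).
by rewrite /= !permE /= !permE /= .
Qed.

Lemma enum3 : enum 'I_3 = [:: o0; o1; o2].
Proof. by apply: (inj_map val_inj); rewrite val_enum_ord. Qed.

Lemma enum2 : enum 'I_2 = [:: ord0; ord_max].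
Proof. by apply: (inj_map val_inj); rewrite val_enum_ord. Qed.

End UnshuffleSums.

(** * Insertion written out on short lists *)

Section InsertionFormulas.
Context {R : realType} {E : lmodType R} (H : int -> E -> Prop).
Implicit Types (x y z : int * E) (s t : seq (int * E)) (K L : vform E) (D : int * E -> E)
  (B : int * E -> int * E -> E).

Definition form12 D B : vform E := fun s =>
  match s with [:: x] => D x | [:: x; y] => B x y | _ => 0 end.

Lemma form12_eq0 D B s : (size s != 1)%N -> (size s != 2)%N -> form12 D B s = 0.
Proof. by case: s => [|? [|? [|? ?]]]. Qed.

Lemma size_permute s (sigma : 'S_(size s)) : size (permute sigma) = size s.
Proof. by rewrite size_map size_enum_ord. Qed.

Lemma permute_homogeneous s (sigma : 'S_(size s)) :
  homogeneous H s -> homogeneous H (permute sigma).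
Proof.
by move=> hs x /mapP [i _ ->]; apply: hs; rewrite mem_nth.
Qed.

Lemma degsum1 x : degsum [:: x] = x.1 :> int.
Proof. by rewrite /degsum big_seq1. Qed.

Lemma degsum2 x y : degsum [:: x; y] = x.1 + y.1 :> int.
Proof. by rewrite /degsum big_cons big_seq1. Qed.

Let o0 : 'I_3 := Ordinal (isT : 0 < 3)%N.
Let o1 : 'I_3 := Ordinal (isT : 1 < 3)%N.
Let o2 : 'I_3 := Ordinal (isT : 2 < 3)%N.

Lemma prod_ord2 (F : 'I_2 -> R) : \prod_i F i = F ord0 * F ord_max.
Proof.
rewrite !big_ord_recl big_ord0 mulr1; congr (F _ * F _); exact: val_inj.
Qed.

Lemma prod_ord3 (F : 'I_3 -> R) : \prod_i F i = F o0 * F o1 * F o2.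
Proof.
rewrite !big_ord_recl big_ord0 mulr1 mulrA; congr (F _ * F _ * F _); exact: val_inj.
Qed.

Lemma forall_ord2 (P : pred 'I_2) : [forall i, P i] = P ord0 && P ord_max.
Proof.
apply/forallP/andP => [h|[h0 h1] [[|[|k]] hk]] //.
  by rewrite (_ : Ordinal hk = ord0) //; exact: val_inj.
by rewrite (_ : Ordinal hk = ord_max) //; exact: val_inj.
Qed.

Lemma forall_ord3 (P : pred 'I_3) : [forall i, P i] = [&& P o0, P o1 & P o2].
Proof.
apply/forallP/and3P => [h|[h0 h1 h2] [[|[|[|k]]] hk]] //.
- by rewrite (_ : Ordinal hk = o0) //; exact: val_inj.
- by rewrite (_ : Ordinal hk = o1) //; exact: val_inj.
- by rewrite (_ : Ordinal hk = o2) //; exact: val_inj.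
Qed.

Lemma permute2 x y (sigma : 'S_2) : permute (s := [:: x; y]) sigma =
  [:: nth (0, 0) [:: x; y] (sigma ord0); nth (0, 0) [:: x; y] (sigma ord_max)].
Proof. by rewrite /permute /= enum2. Qed.

Lemma permute3 x y z (sigma : 'S_3) : permute (s := [:: x; y; z]) sigma =
  [:: nth (0, 0) [:: x; y; z] (sigma o0); nth (0, 0) [:: x; y; z] (sigma o1);
      nth (0, 0) [:: x; y; z] (sigma o2)].
Proof. by rewrite /permute /= enum3. Qed.

Lemma koszul2 x y (sigma : 'S_2) : koszul (s := [:: x; y]) sigma =
  if (sigma ord_max < sigma ord0)%N then (-1) ^ ((nth (0, 0) [:: x; y] (sigma ord0)).1 *
    (nth (0, 0) [:: x; y] (sigma ord_max)).1) else 1.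
Proof.
rewrite /koszul /=; under eq_bigr => i _ do rewrite big_mkcond prod_ord2.
rewrite prod_ord2 /=.
by rewrite !(mulr1, mul1r).
Qed.

Lemma koszul3 x y z (sigma : 'S_3) (a := fun i => (nth (0, 0) [:: x; y; z] (sigma i)).1) :
  koszul (s := [:: x; y; z]) sigma =
  (if (sigma o1 < sigma o0)%N then (-1) ^ (a o0 * a o1) else 1) *
  (if (sigma o2 < sigma o0)%N then (-1) ^ (a o0 * a o2) else 1) *
  (if (sigma o2 < sigma o1)%N then (-1) ^ (a o1 * a o2) else 1).
Proof.
rewrite /koszul /=; under eq_bigr => i _ do rewrite big_mkcond prod_ord3.
rewrite prod_ord3 /=.
by rewrite !(mulr1, mul1r).
Qed.

Lemma unshuffle2 k (sigma : 'S_2) : unshuffle k sigma =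
  ((1 < k) || (k <= 0))%N ==> (sigma ord0 < sigma ord_max)%N.
Proof.
by rewrite /unshuffle forall_ord2 !forall_ord2 /= !andbT.
Qed.

Lemma unshuffle3 k (sigma : 'S_3) : unshuffle k sigma =
  [&& ((1 < k) || (k <= 0))%N ==> (sigma o0 < sigma o1)%N,
      ((2 < k) || (k <= 0))%N ==> (sigma o0 < sigma o2)%N &
      ((2 < k) || (k <= 1))%N ==> (sigma o1 < sigma o2)%N].
Proof.
by rewrite /unshuffle forall_ord3 !forall_ord3 /= !andbT andbA.
Qed.

Variables (dK : int) (D D' : int * E -> E) (B B' : int * E -> int * E -> E).
Hypothesis D'0 : forall e, D' (e, 0) = 0.
Hypothesis B'0 : forall e y, H y.1 y.2 -> B' (e, 0) y = 0.
Let K := form12 D B.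
Let L := form12 D' B'.

Lemma form12_0l e t : homogeneous H t -> L ((e, 0) :: t) = 0.
Proof. by case: t => [|y [|]] //= ht; rewrite B'0 //; apply: ht; rewrite mem_head. Qed.

(** A term survives only if [K] receives one or two arguments and the list given to [L], of size
    [size s - k + 1], has at most two elements. When the inner value is zero, [D'0] and [B'0] make
    the outer one vanish. *)
Lemma iota_term0 s k (sigma : 'S_(size s)) : homogeneous H s -> (k <= size s)%N ->
  [|| k == 0, 2 < k | k.+1 < size s]%N ->
  L ((degsum (take k (permute sigma)) + dK, K (take k (permute sigma)))
       :: drop k (permute sigma)) = 0.
Proof.
move=> hs ks; have ht := permute_homogeneous (sigma := sigma) hs.
have sz := size_permute sigma.
have [k2|k2] := boolP (k.+1 < size s)%N.
  by move=> _; apply: form12_eq0; rewrite /= size_drop sz; lia.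
rewrite orbF => H1; rewrite [K _]form12_eq0 ?size_take ?sz; try by (case: ltnP; lia).
by apply: form12_0l => x /mem_drop; exact: ht.
Qed.

Lemma iotaRN_ge4 s : homogeneous H s -> (3 < size s)%N -> iotaRN dK K L s = 0.
Proof.
move=> hs s3; rewrite /iotaRN big1 // => k _; rewrite big1 // => sigma _; cbv zeta.
by rewrite iota_term0 ?scaler0 //; have := ltn_ord k; lia.
Qed.

Lemma iotaRN_0 : iotaRN dK K L [::] = 0.
Proof.
rewrite /iotaRN big1 // => k _; rewrite big1 // => sigma _; cbv zeta.
by rewrite iota_term0 ?scaler0 //; have := ltn_ord k => /=; lia.
Qed.

Lemma iotaRN_1 x : H x.1 x.2 -> iotaRN dK K L [:: x] = D' (x.1 + dK, D x).
Proof.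
move=> hx; have hs : homogeneous H [:: x] by move=> y; rewrite inE => /eqP ->.
rewrite /iotaRN big_ord_recl big1 ?add0r; last first.
  by move=> sigma _; cbv zeta; rewrite (@iota_term0 [:: x]) ?scaler0.
rewrite big_ord_recl big_ord0 addr0 big_mkcond sum_perm1 ifT; last first.
  by apply/forallP => i; apply/forallP => j; rewrite !ord1.
have -> : permute (s := [:: x]) 1%g = [:: x].
  by rewrite /permute /= enum_ordSl enum_ord0 /= perm1.
rewrite /= degsum1 /koszul big1 ?scale1r // => i _; rewrite big1 // => j.
by rewrite !ord1.
Qed.

Lemma iotaRN_2 x y : H x.1 x.2 -> H y.1 y.2 -> iotaRN dK K L [:: x; y] =
  B' (x.1 + dK, D x) y + (-1 : R) ^ (x.1 * y.1) *: B' (y.1 + dK, D y) x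
  + D' (x.1 + y.1 + dK, B x y).
Proof.
move=> hx hy; have hs : homogeneous H [:: x; y] by move=> z; rewrite !inE => /orP[] /eqP ->.
rewrite /iotaRN big_ord_recl big1 ?add0r; last first.
  by move=> sigma _; cbv zeta; rewrite (@iota_term0 [:: x; y]) ?scaler0.
rewrite big_ord_recl big_ord_recl big_ord0 addr0 !(big_mkcond (fun sigma : 'S_2 => unshuffle _ _)).
rewrite !(sum_perm_seq _ perms2_uniq) // !big_cons !big_nil !addr0 !unshuffle2 !permute2 !koszul2 /=.
rewrite !perm1 !tpermL !tpermR /= !degsum1 !degsum2 scale1r addr0.
by rewrite scale1r [y.1 * x.1]mulrC.
Qed.

Lemma iotaRN_3 x y z : H x.1 x.2 -> H y.1 y.2 -> H z.1 z.2 ->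
  iotaRN dK K L [:: x; y; z] =
  B' (x.1 + y.1 + dK, B x y) z
  + (-1 : R) ^ (y.1 * z.1) *: B' (x.1 + z.1 + dK, B x z) y
  + (-1 : R) ^ (x.1 * (y.1 + z.1)) *: B' (y.1 + z.1 + dK, B y z) x.
Proof.
move=> hx hy hz.
have hs : homogeneous H [:: x; y; z] by move=> w; rewrite !inE => /or3P[] /eqP ->.
rewrite /iotaRN big_ord_recl big1 ?add0r; last first.
  by move=> sigma _; cbv zeta; rewrite (@iota_term0 [:: x; y; z]) ?scaler0.
rewrite big_ord_recl big1 ?add0r; last first.
  by move=> sigma _; cbv zeta; rewrite (@iota_term0 [:: x; y; z]) ?scaler0.
rewrite big_ord_recl big_ord_recl big_ord0 addr0 [X in _ + X]big1 ?addr0; last first.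
  by move=> sigma _; cbv zeta; rewrite (@iota_term0 [:: x; y; z]) ?scaler0.
rewrite big_mkcond (sum_perm_seq _ perms3_uniq) // /perms3 !big_cons !big_nil !addr0.
rewrite !unshuffle3 !permute3 !koszul3 /= !permE /= !permE /=.
rewrite !degsum2 !mul1r scale1r !add0r !addr0 [z.1 * y.1]mulrC.
rewrite [LHS]addrA [RHS]addrAC; congr (_ + _ *: _ + _).
by rewrite -expfzDr ?oppr_eq0 ?oner_eq0 //; congr (_ ^ _); ring.
Qed.

End InsertionFormulas.

(** * Substitution of forms that agree on homogeneous arguments *)

Section RNCongruence.
Context {R : realType} {E : lmodType R} (H : int -> E -> Prop).
Implicit Types (s : seq (int * E)) (K L : vform E).

(** The value of [K] becomes an argument of [L]; substitution under an insertion therefore requires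
    that [K] produce homogeneous values. *)
Lemma iotaRN_ext dK K K' L L' s :
  (forall s, homogeneous H s -> H (degsum s + dK) (K s)) ->
  (forall s, homogeneous H s -> K s = K' s) ->
  (forall s, homogeneous H s -> L s = L' s) ->
  homogeneous H s -> iotaRN dK K L s = iotaRN dK K' L' s.
Proof.
move=> hK KK' LL' hs; rewrite /iotaRN; apply: eq_bigr => k _; apply: eq_bigr => sigma _.
have ht := permute_homogeneous (sigma := sigma) hs; cbv zeta.
have h1 : homogeneous H (take k (permute sigma)) by move=> x /mem_take; exact: ht.
rewrite -KK' // LL' // => x; rewrite inE => /orP[/eqP ->|/mem_drop]; last exact: ht.
exact: hK.
Qed.

Lemma RN_ext dK dL K K' L L' s :
  (forall s, homogeneous H s -> H (degsum s + dK) (K s)) ->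
  (forall s, homogeneous H s -> H (degsum s + dL) (L s)) ->
  (forall s, homogeneous H s -> K s = K' s) ->
  (forall s, homogeneous H s -> L s = L' s) ->
  homogeneous H s -> RN dK dL K L s = RN dK dL K' L' s.
Proof.
by move=> hK hL KK' LL' hs; rewrite /RN (iotaRN_ext hK KK' LL') // (iotaRN_ext hL LL' KK').
Qed.

End RNCongruence.

(** * Forms whose components are multiderivations *)

Section MultiderivationForms.
Context {R : realType} {n : nat} {M : manifold R n} {r : nat}.
Variable (A : vbundle M r).
Local Notation E := (M -> ext R r).
Local Notation H := (GammaExt2 A).
Implicit Types (x y z : int * E) (d : int) (D : int * E -> E)
  (B : int * E -> int * E -> E).

Lemma form12_hom d D B s : deriv A d D -> biderivation A d B ->
  homogeneous H s -> H (degsum s + d) (form12 D B s).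
Proof.
move=> [Dh _ _] bB; case: s => [|[e P] [|y [|z s]]] hs; try exact: hom0.
  by rewrite degsum1; apply: Dh; apply: (hs (e, P)); rewrite mem_head.
by rewrite degsum2; apply: bideriv_hom => //; apply: hs; rewrite !inE eqxx ?orbT.
Qed.

Lemma form12_sym_vform d D B : deriv A d D -> biderivation A d B ->
  sym_vform H d (form12 D B).
Proof.
move=> dD bB; split; first by move=> s; exact: form12_hom.
- move=> s t e a u v hs ht hu hv.
  case: s hs => [|x [|y s]] hs /=; last first.
  + by case: s {hs} => [|? ?] /=; rewrite scaler0 addr0.
  + have hx : H x.1 x.2 by apply: hs; rewrite mem_head.
    case: t ht => [|? ?] _ /=; last by rewrite scaler0 addr0.
    by have [_ DL _] := bB.1 x hx; exact: DL.
  + case: t ht => [|y [|? ?]] ht /=; last by rewrite scaler0 addr0.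
      by have [_ DL _] := dD; exact: DL.
    by apply: (bideriv_linl bB) => //; apply: ht; rewrite mem_head.
- move=> s t x y hs ht hx hy.
  case: s hs => [|u [|v s]] hs /=; last by case: s {hs} => [|? ?] /=; rewrite scaler0.
  + by case: t ht => [|? ?] _ /=; [exact: bB.2|rewrite scaler0].
  + by rewrite scaler0.
Qed.

Lemma bideriv_closed d B : biderivation A d B ->
  forall e y, H y.1 y.2 -> B (e, 0) y = 0.
Proof. by move=> bB e y hy; exact: (bideriv0l bB). Qed.

Lemma RN_form12 d D B D' B' : deriv A 0 D -> biderivation A 0 B ->
  deriv A d D' -> biderivation A d B' ->
  let RNK := RN 0 d (form12 D B) (form12 D' B') in
  [/\ RNK [::] = 0,
      forall x, H x.1 x.2 -> RNK [:: x] = D' (x.1 + 0, D x) - D (x.1 + d, D' x),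
      forall x y, H x.1 x.2 -> H y.1 y.2 ->
        RNK [:: x; y] = bracket12 0 d D B' x y - bracket12 d 0 D' B x y,
      forall x y z, H x.1 x.2 -> H y.1 y.2 -> H z.1 z.2 ->
        RNK [:: x; y; z] = bracket22 0 d B B' x y z &
      forall s, homogeneous H s -> (3 < size s)%N -> RNK s = 0].
Proof.
move=> dD bB dD' bB' RNK.
have D0 e := deriv0 e dD; have D'0 e := deriv0 e dD'.
have B0 := bideriv_closed bB; have B'0 := bideriv_closed bB'.
rewrite /RNK /RN mul0r expr0z; split.
- by rewrite !(iotaRN_0 (H := H)) // scaler0 subr0.
- by move=> x hx; rewrite !(iotaRN_1 (H := H)) // scale1r.
- move=> x y hx hy; rewrite !(iotaRN_2 (H := H)) // scale1r /bracket12.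
  by apply/funext => m; apply/ffunP => S; rewrite !(sectionDE, sectionZE, sectionNE); ring.
- by move=> x y z hx hy hz; rewrite !(iotaRN_3 (H := H)) // scale1r.
- by move=> s hs s3; rewrite !(iotaRN_ge4 (H := H)) // scaler0 subr0.
Qed.

(** Serves for $\underline N + \underline\alpha$ against [l2] and against its deformation by $N$,
    and for $\underline{N^2} + \underline{\alpha_N}$ against [l2]. Each time a closedness identity
    removes the component of arity 3. *)
Lemma RN_quadratic d D B B' : deriv A 0 D -> biderivation A 0 B ->
  biderivation A d B' ->
  (forall x y z, H x.1 x.2 -> H y.1 y.2 -> H z.1 z.2 -> bracket22 0 d B B' x y z = 0) ->
  forall s, homogeneous H s ->
    RN 0 d (form12 D B) (form12 (fun=> 0) B') s =
    form12 (fun=> 0) (bracket12 0 d D B') s.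
Proof.
move=> dD bB bB' B22 s hs.
have [R0 R1 R2 R3 R4] := RN_form12 dD bB (deriv_cst0 A d) bB'.
case: s hs => [|x [|y [|z [|w s]]]] hs //=.
- by rewrite R1 ?(deriv0 _ dD) ?subr0 //; apply: hs; rewrite mem_head.
- have hx : H x.1 x.2 by apply: hs; rewrite !inE eqxx.
  have hy : H y.1 y.2 by apply: hs; rewrite !inE eqxx orbT.
  rewrite R2 // [X in _ - X]/bracket12 !(bideriv0l bB) // scaler0 addr0 !subr0.
  by [].
- by rewrite R3 // ?B22 //; apply: hs; rewrite !inE eqxx ?orbT.
- exact: R4.
Qed.

Lemma biderivation_sub d B B' : biderivation A d B -> biderivation A d B' ->
  biderivation A d (fun x y => B x y - B' x y).
Proof.
move=> bB bB'; split=> [x hx|x y hx hy].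
  have d1 := deriv_lin (-1) (bB'.1 x hx) (bB.1 x hx).
  by apply: deriv_ext d1 => y hy; rewrite scaleN1r addrC.
by rewrite (bB.2 x y) // (bB'.2 x y) // scalerBr.
Qed.

(** Two functions give degree $d - 4 < -2$, and a function and a section give $d - 3$, which is
    below -2 unless [d] is positive. *)
Lemma bideriv_gen d B : biderivation A d B -> d <= 1 ->
  (forall X Y, Gamma A X -> Gamma A Y -> B (-1, mvvec X) (-1, mvvec Y) = 0) ->
  (0 < d -> forall X f, Gamma A X -> Cinf f -> B (-1, mvvec X) (-2, mvfun r f) = 0) ->
  forall x y, H x.1 x.2 -> H y.1 y.2 -> B x y = 0.
Proof.
move=> bB d1 BXY BXf; apply: (bideriv_eq0 bB) => x y gx gy.
have hB := bideriv_hom bB (generator_hom gx) (generator_hom gy).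
have [d0|d0] := ltP 0 d; last first.
  case: gx gy hB => [[f sf ->]|[X sX ->]] [[g sg ->]|[Y sY ->]] hB; last exact: BXY.
  - by apply: (hom_neg hB) => /=; lia.
  - by apply: (hom_neg hB) => /=; lia.
  - by apply: (hom_neg hB) => /=; lia.
case: gx gy hB => [[f sf ->]|[X sX ->]] [[g sg ->]|[Y sY ->]] hB.
- by apply: (hom_neg hB) => /=; lia.
- rewrite bB.2 ?BXf ?scaler0 //; [exact: GammaExtP_fun|exact: GammaExtP_vec].
- exact: BXf.
- exact: BXY.
Qed.

(** Three generators have total degree at most -3, with equality only for three sections. *)
Lemma trideriv_gen d T : triderivation A d T -> d <= 1 ->
  (0 < d -> forall X Y Z, Gamma A X -> Gamma A Y -> Gamma A Z ->
     T (-1, mvvec X) (-1, mvvec Y) (-1, mvvec Z) = 0) ->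
  forall x y z, H x.1 x.2 -> H y.1 y.2 -> H z.1 z.2 -> T x y z = 0.
Proof.
move=> tT d1 TXYZ; apply: (trideriv_eq0 tT) => x y z gx gy gz.
have [TD _ _] := tT.
have [Th _ _] := TD x y (generator_hom gx) (generator_hom gy).
have hT := Th _ _ (generator_hom gz).
rewrite -surjective_pairing in hT.
have xle w : generator A w -> w.1 <= -1 by case=> [[f _ ->]|[X _ ->]].
have [lt3|] := ltP (z.1 + (x.1 + y.1 + d) + 2) 0; first exact: hom_neg hT lt3.
move=> ge0; have := xle _ gx; have := xle _ gy; have := xle _ gz => z1 y1 x1.
have x2 : x.1 = -1 by lia.
have y2 : y.1 = -1 by lia.
have z2 : z.1 = -1 by lia.
have d0 : 0 < d by lia.
have gX w : generator A w -> w.1 = -1 -> exists2 X, Gamma A X & w = (-1, mvvec X).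
  by case=> [[f _ ->]|[X sX ->]] //= _; exists X.
have [X sX ->] := gX x gx x2; have [Y sY ->] := gX y gy y2.
by have [Z sZ ->] := gX z gz z2; exact: TXYZ.
Qed.

End MultiderivationForms.

(** * Extensions by derivation *)

Section ExtensionsByDerivation.
Context {R : realType} {n : nat} {M : manifold R n} {r : nat}.
Variable (A : vbundle M r).
Local Notation E := (M -> ext R r).
Local Notation H := (GammaExt2 A).
Implicit Types (f : M -> R) (P Q S : E) (X Y Z : M -> 'rV[R]_r)
  (s t u : seq (M -> 'rV[R]_r)).

Lemma combE (a : R) (p q : ext R r) (S : {set 'I_r}) :
  (a *: p + q) S = a * p S + q S.
Proof. by rewrite !ffunE. Qed.

Lemma wedge_combl f P P' Q : wedge (fun m => f m *: P m + P' m) Q =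
  (fun m => f m *: wedge P Q m + wedge P' Q m).
Proof. by apply/funext => m; rewrite /wedge extmulDl extmulZl. Qed.

Lemma wedge_combr f P Q Q' : wedge P (fun m => f m *: Q m + Q' m) =
  (fun m => f m *: wedge P Q m + wedge P Q' m).
Proof. by apply/funext => m; rewrite /wedge extmulDr extmulZr. Qed.

Lemma Gamma_seq_cons X s : Gamma_seq A (X :: s) <-> Gamma A X /\ Gamma_seq A s.
Proof.
split=> [h|[hX hs] [|i]] //; last exact: hs.
by split=> [|i hi]; [exact: (h 0%N)|exact: (h i.+1)].
Qed.

Lemma Gamma_seq_cat s t : Gamma_seq A s -> Gamma_seq A t -> Gamma_seq A (s ++ t).
Proof.
move=> hs ht i; rewrite size_cat nth_cat => sti.
by case: (ltnP i (size s)) => si; [exact: hs|apply: ht; rewrite ltn_subLR].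
Qed.

Lemma mvvec_wedges X : mvvec X = wedges [:: X].
Proof.
by apply/funext => m; rewrite /= /wedge /mvfun scale1r extmul1r.
Qed.

(** * The extension of a (1,1)-tensor *)

Section Tensor.
Variables (N : M -> 'M[R]_r) (uN : E -> E).
Hypothesis uNP : ext_tensor A N uN.

Definition tensor_sum s : E := \sum_(i < size s)
  wedges (set_nth (fun=> 0) s i (tapp N (nth (fun=> 0) s i))).

Lemma tensor_sum_cons X s : tensor_sum (X :: s) =
  wedge (mvvec (tapp N X)) (wedges s) + wedge (mvvec X) (tensor_sum s).
Proof.
rewrite /tensor_sum big_ord_recl /=; congr (_ + _).
rewrite (big_morph (wedge (mvvec X)) (wedgeDr _) (wedge0r _)).
by apply: eq_bigr.
Qed.

Lemma tensor_sum_cat s t : tensor_sum (s ++ t) =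
  wedge (tensor_sum s) (wedges t) + wedge (wedges s) (tensor_sum t).
Proof.
elim: s => [|X s IH].
  rewrite /tensor_sum big_ord0 wedge0l add0r.
  by apply/funext => m; rewrite /wedge /= /mvfun scale1r extmul1l.
rewrite cat_cons !tensor_sum_cons IH wedges_cat wedgeDr !wedgeDl !wedgeA addrA.
by rewrite [in RHS]/= -/(wedges s).
Qed.

(** The defect of the Leibniz rule is linear over functions in [P] and in [Q], which reduces it to
    products of sections; there it is the splitting of the sum over a concatenation. *)
Lemma ext_tensor_deriv : deriv A 0 (fun x => uN x.2).
Proof.
have [uNh uNL uNw] := uNP; split => /=.
- by move=> e P hP; rewrite addr0; exact: uNh.
- move=> e a P Q [hP _] [hQ _]; exact: uNL (Cinf_cst a) hP hQ.
move=> e f P Q hP hQ; rewrite mul0r expr0z scale1r; apply/eqP; rewrite -subr_eq0; apply/eqP.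
apply: (Cinf_linear_eq0 (Phi := fun P => uN (wedge P Q) - (wedge (uN P) Q + wedge P (uN Q)))) hP => [g P1 P2 sg [h1 _] [h2 _]|s hs _].
  have [h3 _] := hQ; have gw := GammaExt_wedge.
  rewrite wedge_combl uNL // ?wedge_combl; try exact: gw.
  rewrite uNL // wedge_combl; apply/funext => m; apply/ffunP => S.
  by rewrite !(sectionDE, sectionNE, combE) /=; ring.
apply: (Cinf_linear_eq0 (Phi := fun Q => uN (wedge (wedges s) Q) - (wedge (uN (wedges s)) Q + wedge (wedges s) (uN Q)))) hQ => [g P1 P2 sg [h1 _] [h2 _]|t ht _].
  have [h3 _] := GammaExtP_wedges hs; have gw := GammaExt_wedge.
  rewrite wedge_combr uNL // ?wedge_combr; try exact: gw.
  rewrite uNL // wedge_combr; apply/funext => m; apply/ffunP => S.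
  by rewrite !(sectionDE, sectionNE, combE) /=; ring.
have hst := Gamma_seq_cat hs ht.
by rewrite -wedges_cat !uNw // -!/(tensor_sum _) tensor_sum_cat subrr.
Qed.

Lemma ext_tensor_fun f : Cinf f -> uN (mvfun r f) = 0.
Proof.
move=> sf; have [_ uNL uNw] := uNP.
have := uNL f _ _ sf (GammaExt_fun (Cinf_cst 1)) (GammaExt0 (A:=A)).
rewrite (uNw [::]) // big_ord0.
have -> : uN (fun=> 0) = 0 by exact: (deriv0 0 ext_tensor_deriv).
have -> : (fun m => f m *: mvfun r (fun=> 1) m + 0) = mvfun r f.
  by apply/funext => m; rewrite /mvfun scale1r addr0.
by move->; apply/funext => m; rewrite scaler0 addr0.
Qed.

Lemma ext_tensor_vec X : Gamma A X -> uN (mvvec X) = mvvec (tapp N X).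
Proof.
move=> sX; have [_ _ uNw] := uNP.
rewrite mvvec_wedges uNw; last by apply/Gamma_seq_cons; split.
by rewrite big_ord_recl big_ord0 addr0 [RHS]mvvec_wedges.
Qed.

End Tensor.

(** * The extension of a 2-form *)

Section Form.
Variables (kappa : M -> 'M[R]_r) (uk : E -> E -> E).
Hypothesis ukP : ext_form A kappa uk.
Hypothesis kappa_skew : forall X Y, Gamma A X -> Gamma A Y ->
  feval kappa X Y = - feval kappa Y X.

Definition form_sum s t : E :=
  fun m => \sum_(i < size s) \sum_(j < size t)
    ((-1) ^+ (3 * size s + 2 * size t + i.+1 + j.+1 + 1)
      * feval kappa (nth (fun=> 0) s i) (nth (fun=> 0) t j) m)
    *: wedge (wedges (omit i s)) (wedges (omit j t)) m.

Lemma sign_eq (a b : nat) : odd a = odd b -> (-1 : R) ^+ a = (-1) ^+ b.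
Proof. by rewrite -(signr_odd R a) -(signr_odd R b) => ->. Qed.

Lemma size_omit (T : Type) i (s : seq T) : (i < size s)%N ->
  size (omit i s) = (size s).-1.
Proof. by move=> si; rewrite /omit size_cat size_take size_drop si; lia. Qed.

Lemma exthom_omit i s m : (i < size s)%N -> exthom (size s).-1 (wedges (omit i s) m).
Proof.
move=> si; have := @exthom_extprod R r [seq Y m | Y : M -> 'rV[R]_r <- omit i s].
by rewrite -wedges_extprod size_map size_omit.
Qed.

Lemma wedge1l P : wedge (wedges [::]) P = P.
Proof. by apply/funext => m; rewrite /wedge /= /mvfun scale1r extmul1l. Qed.

(** The term contracting [X] matches because the sign does not depend on the parity of [size t]. In
    the others, with $p$ the size of [s], [X] moves past $p - 1$ factors and the index [j] shifts by
    one, which gives $(-1)^p$. *)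
Lemma form_sum_cons s X t :
  form_sum s (X :: t) = wedge (form_sum s [:: X]) (wedges t)
    + (-1 : R) ^ (size s)%:Z *: wedge (mvvec X) (form_sum s t).
Proof.
apply/funext => m.
rewrite fctE /wedge /form_sum extmul_suml -[((-1 : R) ^ _ *: _) m]/(_ *: _) extmul_sumr.
rewrite scaler_sumr -big_split; apply: eq_bigr => i _.
rewrite [LHS]big_ord_recl; congr (_ + _).
  rewrite big_ord_recl big_ord0 addr0 extmulZl /=; congr (_ *: _).
    congr (_ * _); by apply: sign_eq; rewrite !oddD !oddM.
  by rewrite /omit /= drop0 /wedge /mvfun scale1r extmul1r.
rewrite extmul_sumr scaler_sumr; apply: eq_bigr => j _.
rewrite extmulZr scalerA mulrA /omit /= add0n.
rewrite -/(omit i s) -/(omit j t) /bump add1n -/(omit j t).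
set W := wedges (omit i s); set V := wedges (omit j t).
have hW : exthom (size s).-1 (W m) by exact: exthom_omit.
rewrite /wedge extmulA (extmulC hW (@exthom_vec R r (X m))) extmulZl -extmulA.
rewrite scalerA; congr (_ *: _); rewrite muln1 -exprnP mulrAC -exprD -exprD.
congr (_ * _); apply: sign_eq; rewrite !oddD !oddM /=; have := ltn_ord i.
move: (nat_of_ord i) (nat_of_ord j) => i' j'; move: (size s) => [|p] //= _.
by case: (odd p); case: (odd i'); case: (odd j'); case: (odd (size t)).
Qed.

Lemma form_sum_nil s : form_sum s [::] = 0.
Proof. by apply/funext => m; rewrite /form_sum big1 // => i _; rewrite big_ord0. Qed.

Lemma form_sum_cat s t u :
  form_sum s (t ++ u) = wedge (form_sum s t) (wedges u)
    + (-1 : R) ^ ((size s)%:Z * (size t)%:Z) *: wedge (wedges t) (form_sum s u).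
Proof.
elim: t => [|X t IH].
  rewrite form_sum_nil wedge0l add0r mulr0 expr0z scale1r.
  by rewrite -[LHS](wedge1l (form_sum s u)).
rewrite cat_cons form_sum_cons IH (form_sum_cons s X t) wedges_cat.
rewrite [wedges (X :: t)]/= -/(wedges t).
rewrite !(wedgeDl, wedgeDr, wedgeZl, wedgeZr) !wedgeA scalerDr scalerA addrA.
congr (_ + _ *: _); rewrite -expfzDr ?oppr_eq0 ?oner_eq0 //; congr (_ ^ _).
by rewrite /= -[(size t).+1]add1n PoszD; ring.
Qed.

(** For sizes $p$ and $q$, the skew-symmetry of [kappa], the exchange of the two products and the
    exchange of $3p + 2q$ with $3q + 2p$ contribute $1 + (p-1)(q-1) + p + q$, which is $pq$ modulo
    2. *)
Lemma form_sum_sym s t : Gamma_seq A s -> Gamma_seq A t ->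
  form_sum s t = (-1 : R) ^ ((size s)%:Z * (size t)%:Z) *: form_sum t s.
Proof.
move=> hs ht; apply/funext => m; rewrite -[RHS]/(_ *: form_sum t s m) /form_sum.
rewrite [in RHS]exchange_big scaler_sumr; apply: eq_bigr => i _.
rewrite scaler_sumr; apply: eq_bigr => j _.
rewrite kappa_skew; [|exact: hs|exact: ht]; rewrite opprfctE.
have hW := exthom_omit (m := m) (ltn_ord i).
have hV := exthom_omit (m := m) (ltn_ord j).
rewrite /wedge (extmulC hW hV) !scalerA; congr (_ *: _).
rewrite -PoszM -exprnP mulrN -mulNr mulrAC mulrA -exprD; congr (_ * _).
rewrite -mulN1r -(expr1 (-1)) -!exprD; apply: sign_eq; rewrite !(oddD, oddM) /=.
have := ltn_ord i; have := ltn_ord j.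
move: (nat_of_ord i) (nat_of_ord j) => i' j'.
move: (size s) (size t) => [|p] [|q] //= _ _.
by case: (odd p); case: (odd q); case: (odd i'); case: (odd j').
Qed.


(** The defect of the Leibniz rule is linear over functions in its three arguments, and
    [form_sum_cat] settles products of sections. The shift by 2 between degree and number of factors
    does not affect the sign. *)
Lemma ext_form_deriv x : H x.1 x.2 -> deriv A (x.1 + 0) (fun y => uk x.2 y.2).
Proof.
have [ukh ukl ukr ukw] := ukP; case: x => d P /= hP; rewrite addr0; have [gP _] := hP.
have gw := @GammaExt_wedge R n M r A.
have guk P' Q' d' e' : H d' P' -> H e' Q' -> H (e' + d') (uk P' Q').
  move=> h1 h2; have := ukh _ _ _ _ h1 h2; congr GammaExtP; ring.
split=> /=; first by move=> e Q hQ; exact: guk.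
  by move=> e a Q Q' [hQ _] [hQ' _]; exact: ukr (Cinf_cst a) gP hQ hQ'.
move=> e f Q S hQ hS; apply/eqP; rewrite -subr_eq0; apply/eqP.
have [gQ _] := hQ; have [gS _] := hS.
pose Phi P Q S := uk P (wedge Q S) -
  (wedge (uk P Q) S + (-1 : R) ^ (d * e) *: wedge Q (uk P S)).
apply: (Cinf_linear_eq0 (Phi := fun P => Phi P Q S)) hP
    => [g P1 P2 sg [h1 _] [h2 _]|s hs sd].
  rewrite /Phi !ukl //; try exact: gw.
  rewrite wedge_combl wedge_combr; apply/funext => m; apply/ffunP => T.
  by rewrite !(sectionDE, sectionNE, sectionZE, combE) /=; ring.
have [gs _] := GammaExtP_wedges hs.
apply: (Cinf_linear_eq0 (Phi := fun Q => Phi (wedges s) Q S)) hQ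
    => [g P1 P2 sg [h1 _] [h2 _]|t ht te].
  rewrite /Phi !wedge_combl !ukr //; try exact: gw.
  rewrite !wedge_combl; apply/funext => m; apply/ffunP => T.
  by rewrite !(sectionDE, sectionNE, sectionZE, combE) /=; ring.
have [gt _] := GammaExtP_wedges ht.
apply: (Cinf_linear_eq0 (Phi := fun S => Phi (wedges s) (wedges t) S)) hS
    => [g P1 P2 sg [h1 _] [h2 _]|u hu uf].
  rewrite /Phi !wedge_combr !ukr //; try exact: gw.
  rewrite !wedge_combr; apply/funext => m; apply/ffunP => T.
  by rewrite !(sectionDE, sectionNE, sectionZE, combE) /=; ring.
rewrite /Phi -wedges_cat !ukw //; last exact: Gamma_seq_cat.
rewrite -!/(form_sum _ _) form_sum_cat // sd te.
have -> : (-1 : R) ^ ((d + 2) * (e + 2)) = (-1) ^ (d * e).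
  by rewrite !signz !(oddzD, oddzM) !addbF.
by rewrite subrr.
Qed.

Lemma ext_form_biderivation : biderivation A 0 (fun x y => uk x.2 y.2).
Proof.
split; first exact: ext_form_deriv.
have [ukh ukl ukr ukw] := ukP.
move=> [d P] [e Q] /= hP hQ; apply/eqP; rewrite -subr_eq0; apply/eqP.
have [gQ _] := hQ.
pose Phi P Q := uk P Q - (-1 : R) ^ (d * e) *: uk Q P.
apply: (Cinf_linear_eq0 (Phi := fun P => Phi P Q)) hP
    => [g P1 P2 sg [h1 _] [h2 _]|s hs sd].
  rewrite /Phi ukl // ukr //; apply/funext => m; apply/ffunP => T.
  by rewrite !(sectionDE, sectionNE, sectionZE, combE) /=; ring.
have [gs _] := GammaExtP_wedges hs.
apply: (Cinf_linear_eq0 (Phi := fun Q => Phi (wedges s) Q)) hQ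
    => [g P1 P2 sg [h1 _] [h2 _]|t ht te].
  rewrite /Phi ukl // ukr //; apply/funext => m; apply/ffunP => T.
  by rewrite !(sectionDE, sectionNE, sectionZE, combE) /=; ring.
rewrite /Phi !ukw // -!/(form_sum _ _) (form_sum_sym hs ht) // sd te.
have -> : (-1 : R) ^ ((d + 2) * (e + 2)) = (-1) ^ (d * e).
  by rewrite !signz !(oddzD, oddzM) !addbF.
by rewrite subrr.
Qed.

Lemma ext_form_vec X Y : Gamma A X -> Gamma A Y ->
  uk (mvvec X) (mvvec Y) = mvfun r (feval kappa X Y).
Proof.
move=> sX sY; have [_ _ _ ukw] := ukP.
rewrite !mvvec_wedges ukw; try by apply/Gamma_seq_cons.
apply/funext => m; rewrite !big_ord_recl !big_ord0 !addr0 /=.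
rewrite /wedge /omit /= /mvfun !scale1r extmul1l; congr (_ *: _).
(* For two sections the exponent of the sign is 8. *)
by rewrite -signr_odd mul1r.
Qed.

End Form.
End ExtensionsByDerivation.

(** * The Schouten bracket and Omega N-structures *)

Section OmegaNijenhuis.
Context {R : realType} {n : nat} {M : manifold R n} {r : nat}.
Variables (A : vbundle M r) (L : lie_algebroid A).
Local Notation E := (M -> ext R r).
Local Notation H := (GammaExt2 A).
Implicit Types (f : M -> R) (P Q S : E) (X Y Z : M -> 'rV[R]_r).

Lemma mvvecD X Y : mvvec (X + Y) = mvvec X + mvvec Y.
Proof. by apply/funext => m; exact: extvecD. Qed.

Lemma mvvecN X : mvvec (- X) = - mvvec X.
Proof. by apply/funext => m; rewrite /mvvec opprfctE -scaleN1r extvecZ scaleN1r. Qed.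

Lemma GammaD X Y : Gamma A X -> Gamma A Y -> Gamma A (X + Y).
Proof.
move=> sX sY j k; have o := @frame_dom_open _ _ _ _ A j.
apply: smooth_fun_eq (smooth_funD o (sX j k) (sY j k)) => // m _.
by rewrite fctE mulmxDl [RHS]mxE.
Qed.

Lemma GammaN X : Gamma A X -> Gamma A (- X).
Proof.
move=> sX j k; have o := @frame_dom_open _ _ _ _ A j.
apply: smooth_fun_eq (smooth_funM o (smooth_fun_cst (-1) o) (sX j k)) => // m _.
by rewrite opprfctE mulNmx [RHS]mxE mulN1r.
Qed.

Lemma mvvec0 : mvvec (0 : M -> 'rV[R]_r) = 0.
Proof. by rewrite -(subrr 0) mvvecD mvvecN subrr. Qed.

Lemma mvfunE f m (T : {set 'I_r}) : mvfun r f m T = f m * ext1 R r T.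
Proof. by rewrite /mvfun ffunE. Qed.

Lemma hom_vec X : Gamma A X -> H (-1) (mvvec X).
Proof. by move=> sX; exact: GammaExtP_vec. Qed.

Lemma hom_fun f : Cinf f -> H (-2) (mvfun r f).
Proof. by move=> sf; exact: GammaExtP_fun. Qed.

(** * The Schouten bracket as a biderivation *)

Section Schouten.
Variable SN : E -> E -> E.
Hypothesis SNP : schouten L SN.

Definition l2_form (x y : int * E) : E := (-1 : R) ^ (x.1 + 2 - 1) *: SN x.2 y.2.

(** The factor $(-1)^{p-1}$ turns the skew-symmetry of the Schouten bracket, graded by $p - 1$, into
    a symmetry graded by $p - 2$. The Leibniz sign $(-1)^{(p-1)q}$ already is that of a derivation
    of degree $p - 1$. *)
Lemma l2_biderivation : biderivation A 1 l2_form.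
Proof.
have [SNh [SNl SNr] _ SNs SNM] := SNP; split=> [[d P] /= hP|[d P] [e Q] /= hP hQ]; last first.
  rewrite /l2_form /= (SNs _ _ _ _ hP hQ) !scalerA; congr (_ *: _).
  rewrite !signz !(oddzN, oddzD, oddzM).
  by case: (oddz d); case: (oddz e); rewrite /=; ring.
have [gP _] := hP; rewrite /l2_form; split => /=.
- move=> e Q hQ; apply: homZ; have := SNh _ _ _ _ hP hQ.
  by congr GammaExtP; ring.
- move=> e a Q Q' [hQ _] [hQ' _]; rewrite SNr // scalerDr !scalerA.
  by congr (_ *: _ + _); rewrite mulrC.
- move=> e f Q S hQ [hS _]; rewrite (SNM _ _ _ _ _ hP hQ hS).
  rewrite wedgeZl wedgeZr; apply/funext => m; apply/ffunP => T.
  rewrite !(sectionDE, sectionZE) !signz !(oddzN, oddzD, oddzM).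
  by case: (oddz d); case: (oddz e); rewrite /=; ring.
Qed.

Lemma l2_vec X Y : Gamma A X -> Gamma A Y ->
  l2_form (-1, mvvec X) (-1, mvvec Y) = mvvec (lbr L X Y).
Proof.
move=> sX sY; have [_ _ [SNX _] _ _] := SNP.
by rewrite /l2_form SNX //= expr0z scale1r.
Qed.

Lemma l2_fun X f : Gamma A X -> Cinf f ->
  l2_form (-1, mvvec X) (-2, mvfun r f) = mvfun r (anchor L X f).
Proof.
move=> sX sf; have [_ _ [_ SNf] _ _] := SNP.
by rewrite /l2_form SNf //= expr0z scale1r.
Qed.

Lemma l2_fun_sym X f : Gamma A X -> Cinf f ->
  l2_form (-2, mvfun r f) (-1, mvvec X) = mvfun r (anchor L X f).
Proof.
move=> sX sf; rewrite (l2_biderivation.2 (-2, _) (-1, _)) /=.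
- by rewrite l2_fun // signz oddzM scale1r.
- exact: hom_fun.
- exact: hom_vec.
Qed.

(** * The identities of an Omega N-structure *)

Section OmegaN.
Variables (alpha N : M -> 'M[R]_r) (uN uN2 : E -> E) (ualpha ualphaN : E -> E -> E).
Hypothesis sN : tensor11 A N.
Hypothesis alphaP : two_form A alpha.
Hypothesis OmegaNP : OmegaN L alpha N.
Hypothesis torsionN : torsion_free L N.
Hypothesis uNP : ext_tensor A N uN.
Hypothesis uN2P : ext_tensor A (tsquare N) uN2.
Hypothesis ualphaP : ext_form A alpha ualpha.
Hypothesis ualphaNP : ext_form A (twist alpha N) ualphaN.

Let D1 (x : int * E) : E := uN x.2.
Let D2 (x : int * E) : E := uN2 x.2.
Let B1 (x y : int * E) : E := ualpha x.2 y.2.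
Let B2 (x y : int * E) : E := ualphaN x.2 y.2.
Let mu := l2_form.
(** The structure deformed by $N$: on sections it is the bracket $[NX,Y] + [X,NY] - N[X,Y]$, and its
    anchor is $\rho \circ N$. *)
Let T := bracket12 0 1 D1 mu.

Lemma feval_skew X Y : feval alpha X Y = - feval alpha Y X.
Proof.
have [aT _] := alphaP; apply/funext => m; rewrite opprfctE /feval.
have <- : (X m *m alpha m *m (Y m)^T)^T ord0 ord0 = (X m *m alpha m *m (Y m)^T) ord0 ord0 by rewrite mxE.
by rewrite !trmx_mul trmxK aT mulNmx mulmxN mulmxA mxE.
Qed.

Lemma feval_twist X Y : feval (twist alpha N) X Y = feval alpha (tapp N X) Y.
Proof. by apply/funext => m; rewrite /feval /twist /tapp !mulmxA. Qed.

Lemma feval_tapp X Y : Gamma A X -> Gamma A Y ->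
  feval alpha X (tapp N Y) = feval alpha (tapp N X) Y.
Proof. by have [aN _ _] := OmegaNP => sX sY; rewrite aN. Qed.

(** Follows from the compatibility of [alpha] and [N]; skew-symmetry on sections is what
    [ext_form_biderivation] asks of the 2-form [twist alpha N]. *)
Lemma twist_skew X Y : Gamma A X -> Gamma A Y ->
  feval (twist alpha N) X Y = - feval (twist alpha N) Y X.
Proof. by move=> sX sY; rewrite !feval_twist -feval_tapp // feval_skew. Qed.

Lemma tapp_square X : tapp (tsquare N) X = tapp N (tapp N X).
Proof. by apply/funext => m; rewrite /tapp /tsquare mulmxA. Qed.

Lemma B1_biderivation : biderivation A 0 B1.
Proof. by apply: ext_form_biderivation ualphaP _ => X Y _ _; exact: feval_skew. Qed.

Lemma B2_biderivation : biderivation A 0 B2.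
Proof. exact: ext_form_biderivation ualphaNP twist_skew. Qed.

Lemma D1_deriv : deriv A 0 D1. Proof. exact: ext_tensor_deriv uNP. Qed.

Lemma D2_deriv : deriv A 0 D2. Proof. exact: ext_tensor_deriv uN2P. Qed.

Let sNX X : Gamma A X -> Gamma A (tapp N X) := @Gamma_tapp _ _ _ _ A N X sN.

(** The function is the value of [uk] on two sections, which is smooth of degree 0 by the axioms of
    [ext_form]. This covers [alpha] and [twist alpha N] alike, with no computation in frames. *)
Lemma Cinf_feval kappa uk X Y : ext_form A kappa uk -> Gamma A X -> Gamma A Y ->
  Cinf (feval kappa X Y).
Proof.
move=> ukP sX sY; apply: (@Cinf_mvfun _ _ _ _ A); rewrite -(ext_form_vec ukP sX sY).
by have [ukh _ _ _] := ukP; exact: (ukh 1 1 _ _ (GammaExtP_vec sX) (GammaExtP_vec sY)).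
Qed.

Lemma T_biderivation : biderivation A 1 T.
Proof. exact: bracket12_biderivation D1_deriv l2_biderivation. Qed.

Lemma T_vec X Y : Gamma A X -> Gamma A Y -> T (-1, mvvec X) (-1, mvvec Y) =
  mvvec (lbr L (tapp N X) Y + lbr L X (tapp N Y) - tapp N (lbr L X Y)).
Proof.
move=> sX sY; rewrite /T /bracket12 /D1 /mu /= !addr0 !(ext_tensor_vec uNP) //.
rewrite !l2_vec //; try exact: sNX.
rewrite (ext_tensor_vec uNP); last exact: lbr_Gamma.
rewrite (@lbr_skew _ _ _ _ _ L (tapp N Y) X) //; last exact: sNX.
by rewrite !(mvvecD, mvvecN) signz oddzM /= scaleN1r opprK.
Qed.

Lemma T_fun X f : Gamma A X -> Cinf f ->
  T (-1, mvvec X) (-2, mvfun r f) = mvfun r (anchor L (tapp N X) f).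
Proof.
move=> sX sf; rewrite /T /bracket12 /D1 /mu /= !addr0 (ext_tensor_vec uNP) //.
rewrite (ext_tensor_fun uNP) // (bideriv0l l2_biderivation); last exact: hom_vec.
rewrite !l2_fun //; last exact: sNX.
rewrite (ext_tensor_fun uNP); last exact: anchor_Cinf.
by rewrite scaler0 addr0 subr0.
Qed.

Lemma T_fun_sym X f : Gamma A X -> Cinf f ->
  T (-2, mvfun r f) (-1, mvvec X) = mvfun r (anchor L (tapp N X) f).
Proof.
move=> sX sf; rewrite (T_biderivation.2 (-2, _) (-1, _)) /=.
- by rewrite T_fun // signz oddzM scale1r.
- exact: hom_fun.
- exact: hom_vec.
Qed.

(* On sections, [kappa, B]_RN is the differential of kappa for the bracket [b] and
   the anchor [a]. *)
Lemma bracket22_form kappa uk (B : int * E -> int * E -> E)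
    (b : (M -> 'rV[R]_r) -> (M -> 'rV[R]_r) -> (M -> 'rV[R]_r))
    (a : (M -> 'rV[R]_r) -> (M -> R) -> (M -> R)) :
  ext_form A kappa uk ->
  (forall X Y, Gamma A X -> Gamma A Y -> feval kappa X Y = - feval kappa Y X) ->
  biderivation A 1 B ->
  (forall X Y, Gamma A X -> Gamma A Y -> Gamma A (b X Y)) ->
  (forall X Y, Gamma A X -> Gamma A Y -> B (-1, mvvec X) (-1, mvvec Y) = mvvec (b X Y)) ->
  (forall X f, Gamma A X -> Cinf f -> B (-2, mvfun r f) (-1, mvvec X) = mvfun r (a X f)) ->
  (forall X Y Z, Gamma A X -> Gamma A Y -> Gamma A Z -> forall m,
    a X (feval kappa Y Z) m - a Y (feval kappa X Z) m + a Z (feval kappa X Y) m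
    - feval kappa (b X Y) Z m + feval kappa (b X Z) Y m - feval kappa (b Y Z) X m = 0) ->
  forall x y z, H x.1 x.2 -> H y.1 y.2 -> H z.1 z.2 ->
    bracket22 0 1 (fun x y => uk x.2 y.2) B x y z = 0.
Proof.
move=> ukP kskew bB bG BXY BfX da.
have tB := bracket22_triderivation (erefl : 0 = 0 :> int) (ext_form_biderivation ukP kskew) bB.
apply: (trideriv_gen tB) => // _ X Y Z sX sY sZ.
rewrite /bracket22 /insert22 /= !(ext_form_vec ukP) // !BXY //.
rewrite !(ext_form_vec ukP) //; try exact: bG.
have sk U V := Cinf_feval ukP (X := U) (Y := V).
rewrite !BfX //; try exact: sk.
apply/funext => m; apply/ffunP => T'.
rewrite !(sectionDE, sectionNE, sectionZE, section0E, mvfunE) !signz !(oddzD, oddzM) /=.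
rewrite -[RHS](mul0r (ext1 R r T')) -(da X Y Z sX sY sZ m); ring.
Qed.

Lemma bracket_alpha_l2 x y z : H x.1 x.2 -> H y.1 y.2 -> H z.1 z.2 ->
  bracket22 0 1 B1 mu x y z = 0.
Proof.
have [_ dalpha _] := OmegaNP.
apply: (bracket22_form (b := lbr L) (a := anchor L) ualphaP) => //.
- by move=> X Y _ _; exact: feval_skew.
- exact: l2_biderivation.
- by move=> X Y; exact: lbr_Gamma.
- exact: l2_vec.
- exact: l2_fun_sym.
- by move=> X Y Z sX sY sZ m; have /(congr1 (fun F => F m)) := dalpha X Y Z sX sY sZ.
Qed.

Lemma bracket_alphaN_l2 x y z : H x.1 x.2 -> H y.1 y.2 -> H z.1 z.2 ->
  bracket22 0 1 B2 mu x y z = 0.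
Proof.
have [_ _ dalpha] := OmegaNP.
apply: (bracket22_form (b := lbr L) (a := anchor L) ualphaNP) => //.
- exact: twist_skew.
- exact: l2_biderivation.
- by move=> X Y; exact: lbr_Gamma.
- exact: l2_vec.
- exact: l2_fun_sym.
- by move=> X Y Z sX sY sZ m; have /(congr1 (fun F => F m)) := dalpha X Y Z sX sY sZ.
Qed.

Lemma fevalDl X X' Y m : feval alpha (X + X') Y m = feval alpha X Y m + feval alpha X' Y m.
Proof. by rewrite /feval fctE !mulmxDl mxE. Qed.

Lemma fevalNl X Y m : feval alpha (- X) Y m = - feval alpha X Y m.
Proof. by rewrite /feval opprfctE !mulNmx mxE. Qed.

(* The differential of alpha for the bracket deformed by N is the sum of the
   d alpha with N inserted in one of the arguments, minus 2 d alpha_N. *)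
Lemma bracket_alpha_T x y z : H x.1 x.2 -> H y.1 y.2 -> H z.1 z.2 ->
  bracket22 0 1 B1 T x y z = 0.
Proof.
have [_ dalpha dalphaN] := OmegaNP.
apply: (bracket22_form (b := fun X Y => lbr L (tapp N X) Y + lbr L X (tapp N Y) - tapp N (lbr L X Y))
  (a := fun X f => anchor L (tapp N X) f) ualphaP).
- by move=> X Y _ _; exact: feval_skew.
- exact: T_biderivation.
- move=> X Y sX sY; apply: GammaD; first by apply: GammaD; apply: lbr_Gamma => //; exact: sNX.
  by apply/GammaN/sNX; exact: lbr_Gamma.
- exact: T_vec.
- exact: T_fun_sym.
move=> X Y Z sX sY sZ m.
have [nX nY nZ] := And3 (sNX sX) (sNX sY) (sNX sZ).
have /(congr1 (fun F => F m)) d1 := dalpha _ _ _ nX sY sZ.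
have /(congr1 (fun F => F m)) d2 := dalpha _ _ _ sX nY sZ.
have /(congr1 (fun F => F m)) d3 := dalpha _ _ _ sX sY nZ.
have /(congr1 (fun F => F m)) d4 := dalphaN _ _ _ sX sY sZ.
rewrite /dA2 !feval_twist in d1 d2 d3 d4.
have bG U V := @lbr_Gamma _ _ _ _ _ L U V.
(* Compatibility moves each [N] to the first argument of [alpha], after which the goal is a linear
   combination of the four identities. *)
rewrite ?feval_tapp in d1 d2 d3 d4; try (by [|exact: bG]).
rewrite !(fevalDl, fevalNl).
lra.
Qed.

Lemma bracket_N_T x y : H x.1 x.2 -> H y.1 y.2 ->
  bracket12 0 1 D1 T x y = bracket12 0 1 D2 mu x y.
Proof.
move=> hx hy; apply/eqP; rewrite -subr_eq0; apply/eqP.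
have bT := bracket12_biderivation D1_deriv T_biderivation.
have bm := bracket12_biderivation D2_deriv l2_biderivation.
apply: (bideriv_gen (biderivation_sub bT bm)) hx hy => // [X Y sX sY|_ X f sX sf].
  have [nX nY nnX nnY] := And4 (sNX sX) (sNX sY) (sNX (sNX sX)) (sNX (sNX sY)).
  have bG U V := @lbr_Gamma _ _ _ _ _ L U V.
  rewrite /bracket12 /D1 /D2 /= !addr0 !(ext_tensor_vec uNP) // !(ext_tensor_vec uN2P) //.
  rewrite !T_vec // /mu !l2_vec ?tapp_square //.
  rewrite (ext_tensor_vec uNP); last first.
    by apply: GammaD; [apply: GammaD|apply: GammaN; apply: sNX]; exact: bG.
  rewrite (ext_tensor_vec uN2P); last exact: bG.
  have := torsionN sX sY => /(congr1 (@mvvec R n M r)).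
  have tD U V : tapp N (U + V) = tapp N U + tapp N V.
    by apply/funext => m; rewrite /tapp fctE mulmxDl.
  have tN U : tapp N (- U) = - tapp N U.
    by apply/funext => m; rewrite /tapp opprfctE mulNmx.
  rewrite !(tD, tN) !tapp_square !(mvvecD, mvvecN) mvvec0.
  rewrite (@lbr_skew _ _ _ _ _ L (tapp N Y) (tapp N X)) //.
  rewrite (@lbr_skew _ _ _ _ _ L (tapp N (tapp N Y)) X) //.
  rewrite (@lbr_skew _ _ _ _ _ L (tapp N Y) X) //.
  rewrite !(tN, mvvecD, mvvecN) => tor.
  apply/funext => m; apply/ffunP => S.
  have /(congr1 (fun F : E => F m S)) := tor.
  rewrite !(sectionDE, sectionNE, sectionZE, section0E) !signz !(oddzD, oddzM) /=.
  lra.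
(* On a section and a function, both brackets are the anchor of $N^2 X$ applied to [f]. *)
rewrite /bracket12 /D1 /D2 /= !addr0 !(ext_tensor_vec uNP) // !(ext_tensor_vec uN2P) //.
have nX := sNX sX; have nnX := sNX nX.
rewrite (ext_tensor_fun uNP) // (ext_tensor_fun uN2P) //.
rewrite (bideriv0l T_biderivation) ?(bideriv0l l2_biderivation); try exact: hom_vec.
rewrite !T_fun // /mu !l2_fun ?tapp_square //.
rewrite (ext_tensor_fun uNP) ?(ext_tensor_fun uN2P) ?subrr //; exact: anchor_Cinf.
Qed.

(** On sections, both sides are $\alpha(N^2 X, Y) - \alpha(N^2 Y, X)$. *)
Lemma bracket_N_alphaN x y : H x.1 x.2 -> H y.1 y.2 ->
  bracket12 0 0 D1 B2 x y = bracket12 0 0 D2 B1 x y.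
Proof.
move=> hx hy; apply/eqP; rewrite -subr_eq0; apply/eqP.
have b1 := bracket12_biderivation D1_deriv B2_biderivation.
have b2 := bracket12_biderivation D2_deriv B1_biderivation.
apply: (bideriv_gen (biderivation_sub b1 b2)) hx hy => // X Y sX sY.
have [nX nY] := (sNX sX, sNX sY).
rewrite /bracket12 /D1 /D2 /B1 /B2 /= !(ext_tensor_vec uNP) // !(ext_tensor_vec uN2P) //.
rewrite !(ext_form_vec ualphaP) ?tapp_square //; try exact: sNX.
rewrite !(ext_form_vec ualphaNP) // !(ext_tensor_fun uNP) ?(ext_tensor_fun uN2P) //;
  try exact: Cinf_feval ualphaP _ _; try exact: Cinf_feval ualphaNP _ _.
by rewrite !feval_twist !subr0 subrr.
Qed.

Lemma commutator_N_N2 x : H x.1 x.2 -> D2 (x.1 + 0, D1 x) = D1 (x.1 + 0, D2 x).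
Proof.
move=> hx; have c := deriv_comm D2_deriv D1_deriv.
apply/eqP; rewrite -subr_eq0; apply/eqP.
have := deriv_eq0 c _ hx; rewrite mulr0 expr0z scale1r; apply=> y.
case=> [[f sf ->]|[X sX ->]]; rewrite /D1 /D2 /=.
  rewrite !(ext_tensor_fun uNP, ext_tensor_fun uN2P) //.
  have [z1 z2] : uN 0 = 0 /\ uN2 0 = 0 by split; [exact: deriv0 0 D1_deriv|exact: deriv0 0 D2_deriv].
  by rewrite z1 z2 scaler0 subrr.
rewrite !(ext_tensor_vec uNP, ext_tensor_vec uN2P) ?tapp_square //; try exact: sNX; last by do 2!apply: sNX.
by rewrite ?mulr0 ?expr0z ?scale1r subrr.
Qed.

(** A form of degree 0 sends three generators to degree at most -3, where every element is zero. *)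
Lemma bracket_alpha_alphaN x y z : H x.1 x.2 -> H y.1 y.2 -> H z.1 z.2 ->
  bracket22 0 0 B1 B2 x y z = 0.
Proof.
have tB := bracket22_triderivation (erefl : 0 = 0 :> int) B1_biderivation B2_biderivation.
exact: (trideriv_gen tB).
Qed.

Lemma OmegaN_nijenhuis_form : nijenhuis_form H (l2 SN)
  (vform_add (vform1 uN) (vform2 ualpha)) (vform_add (vform1 uN2) (vform2 ualphaN)).
Proof.
have formE D B : vform_add (vform1 D) (vform2 B) =
    form12 (fun x : int * E => D x.2) (fun x y => B x.2 y.2).
  apply/funext => s; rewrite /vform_add.
  by case: s => [|x [|y [|z s]]] /=; rewrite ?addr0 ?add0r.
have muE : l2 SN = form12 (fun=> 0) mu by apply/funext; case=> [|x [|y [|z s]]].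
rewrite !formE muE -/D1 -/D2 -/B1 -/B2.
have d0 := deriv_cst0 A 1.
have [bB1 bB2 bmu bT] := And4 B1_biderivation B2_biderivation l2_biderivation T_biderivation.
have [dD1 dD2] := (D1_deriv, D2_deriv).
split; try exact: form12_sym_vform.
move=> s hs; split.
  have hN t : homogeneous H t -> H (degsum t + 0) (form12 D1 B1 t) by exact: form12_hom.
  have hT t : homogeneous H t -> H (degsum t + 1) (form12 (fun=> 0) T t) by exact: form12_hom.
  have TE := RN_quadratic dD1 bB1 bmu bracket_alpha_l2.
  have hTE t : homogeneous H t ->
      H (degsum t + 1) (RN 0 1 (form12 D1 B1) (form12 (fun=> 0) mu) t).
    by move=> ht; rewrite TE; first exact: hT.
  (* The inner bracket is replaced by [T]; [hTE] supplies the homogeneity that this substitution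
     requires. *)
  rewrite (RN_ext hN hTE (fun t _ => erefl) TE hs).
  rewrite (RN_quadratic dD1 bB1 bT bracket_alpha_T hs).
  rewrite (RN_quadratic dD2 bB2 bmu bracket_alphaN_l2 hs).
  case: s hs => [|x [|y [|z s]]] hs; [by []|by []| |by []].
  by apply: bracket_N_T; apply: hs; rewrite !inE eqxx ?orbT.
(* The commutation of the form with its square, one arity at a time. *)
have [R0 R1 R2 R3 R4] := RN_form12 dD1 bB1 dD2 bB2.
case: s hs => [|x [|y [|z [|w s]]]] hs.
- exact: R0.
- by rewrite R1 ?commutator_N_N2 ?subrr //; apply: hs; rewrite !inE eqxx.
- by rewrite R2 ?bracket_N_alphaN ?subrr //; apply: hs; rewrite !inE eqxx ?orbT.
- by rewrite R3 ?bracket_alpha_alphaN //; apply: hs; rewrite !inE eqxx ?orbT.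
- exact: R4.
Qed.

End OmegaN.
End Schouten.
End OmegaNijenhuis.

Theorem proposition7p5 (R : realType) (n : nat) (M : manifold R n) (r : nat)
    (A : vbundle M r) (L : lie_algebroid A)
    (SN : (M -> ext R r) -> (M -> ext R r) -> (M -> ext R r))
    (alpha N : M -> 'M[R]_r)
    (uN uN2 : (M -> ext R r) -> (M -> ext R r))
    (ualpha ualphaN : (M -> ext R r) -> (M -> ext R r) -> (M -> ext R r)) :
  schouten L SN ->
  tensor11 A N ->
  two_form A alpha ->
  OmegaN L alpha N ->
  torsion_free L N ->
  ext_tensor A N uN ->
  ext_tensor A (tsquare N) uN2 ->
  ext_form A alpha ualpha ->
  ext_form A (twist alpha N) ualphaN ->
  nijenhuis_form (GammaExt2 A) (l2 SN)
    (vform_add (vform1 uN) (vform2 ualpha))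
    (vform_add (vform1 uN2) (vform2 ualphaN)).
Proof.
move=> SNP sN alphaP OmegaNP torsionN uNP uN2P ualphaP ualphaNP.
exact: (OmegaN_nijenhuis_form SNP sN alphaP OmegaNP torsionN uNP uN2P ualphaP ualphaNP).
Qed.
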